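(* Let $R$ be a real closed field, let $M\subset R^n$ be a semialgebraic set, let $\mathcal S^{\diamond}(M)$ denote either $\mathcal S(M)$ or $\mathcal S^*(M)$, and let $\mathfrak p\subset\mathcal S^{\diamond}(M)$ be a prime ideal. Then: (i) The transcendence degree over $R$ of the real closed field $\operatorname{qf}(\mathcal S^{\diamond}(M)/\mathfrak p)$ is finite and bounded above by $\dim M$. (ii) If $\mathfrak p$ is moreover a prime $z$-ideal of $\mathcal S(M)$, then ${\tt d}_M(\mathfrak p)=\operatorname{tr\,deg}_R(\operatorname{qf}(\mathcal S(M)/\mathfrak p))$.
   Context: $R$ is a real closed field and $R^n$ carries the (Euclidean) topology induced by the order of $R$. A subset of $R^n$ is semialgebraic if it can be described by a finite boolean combination of polynomial equations and inequalities with coefficients in $R$. A continuous map $f:M\to N$ between semialgebraic sets is semialgebraic if its graph is a semialgebraic set; when $N=R$ it is called a semialgebraic function (so semialgebraic functions are always continuous). $\mathcal S(M)$ is the commutative ring of all (continuous) semialgebraic functions $M\to R$ with pointwise operations, and $\mathcal S^*(M)\subset\mathcal S(M)$ is its subring of bounded semialgebraic functions. For $f\in\mathcal S(M)$, $Z(f):=\{x\in M: f(x)=0\}$. An ideal $\mathfrak a$ of $\mathcal S(M)$ is a $z$-ideal if whenever $f\in\mathfrak a$ and $g\in\mathcal S(M)$ satisfy $Z(f)\subset Z(g)$, then $g\in\mathfrak a$. The semialgebraic depth of a prime ideal $\mathfrak p$ of $\mathcal S(M)$ is ${\tt d}_M(\mathfrak p):=\min\{\dim(Z(f)): f\in\mathfrak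 p\}$, where $\dim$ of a semialgebraic set is its usual dimension (equal to the dimension of its Zariski closure). $\operatorname{qf}(A)$ is the field of fractions of a domain $A$; for every prime ideal $\mathfrak p$ of $\mathcal S^{\diamond}(M)$ the field $\operatorname{qf}(\mathcal S^{\diamond}(M)/\mathfrak p)$ is real closed and contains $R$ via the constant functions. *)

(* Defs.v *)
From HB Require Import structures.
From mathcomp Require Import all_boot all_order all_algebra.
From mathcomp Require Import boolp classical_sets functions constructive_ereal.
From mathcomp Require Import ordered_qelim qe_rcf.
From mathcomp Require mpoly.
(* The notations of mpoly cannot be loaded together with those of
   classical_sets; [mpoly n R] is the polynomial ring R[X_0, ..., X_(n-1)]. *)
Import -(notations) mpoly.

Set Implicit Arguments.
Unset Strict Implicit.
Unset Printing Implicit Defensive.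

Import Order.TTheory GRing.Theory Num.Theory.

Local Open Scope ring_scope.
Local Open Scope classical_set_scope.

Inductive semialgebraic (R : rcfType) (n : nat) : set 'rV[R]_n -> Prop :=
| SemialgEq0 (p : mpoly n R) : semialgebraic [set x | meval (x 0) p = 0]
| SemialgGt0 (p : mpoly n R) : semialgebraic [set x | 0 < meval (x 0) p]
| SemialgC A : semialgebraic A -> semialgebraic (~` A)
| SemialgI A B : semialgebraic A -> semialgebraic B -> semialgebraic (A `&` B)
| SemialgU A B : semialgebraic A -> semialgebraic B -> semialgebraic (A `|` B).

Record semialg_set (R : rcfType) (n : nat) := SemialgSet {
  semialg_carrier :> set 'rV[R]_n;
  semialg_setP : semialgebraic semialg_carrier }.

(** Tarski-Seidenberg: the semialgebraic sets are the first-order definable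
    ones.  The condition on [definable] is for every environment [e], so that
    the variables of index at least [n] are dummies. *)

Section Definable.
Variable R : rcfType.

Definition env_row n (e : seq R) : 'rV[R]_n := \row_i e`_i.

Definition definable n (A : set 'rV[R]_n) : Prop :=
  exists F : ord.formula R, forall e, ord.holds e F <-> A (env_row n e).

Lemma term_of_mpoly n (p : mpoly n R) :
  exists t : GRing.term R, forall e,
    GRing.eval e t = meval ((env_row n e) 0) p.
Proof.
elim/mpolyind: p => [|c m p _ _ [t tP]].
  by exists (GRing.Const 0) => e; rewrite raddf0.
suff [u uP] : exists u : GRing.term R, forall e,
    GRing.eval e u = meval ((env_row n e) 0) (mpolyX R m).
  exists (GRing.Add (GRing.Mul (GRing.Const c) u) t) => e /=.
  by rewrite uP tP mevalD mevalZ.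
suff [u uP] : exists u : GRing.term R, forall e,
    GRing.eval e u = \prod_(i <- enum 'I_n) ((env_row n e) 0 i) ^+ (m i).
  by exists u => e; rewrite uP mevalX big_enum.
elim: (enum 'I_n) => [|i s [u uP]].
  by exists (GRing.Const 1) => e; rewrite big_nil.
exists (GRing.Mul (GRing.Exp (GRing.Var R i) (m i)) u) => e.
by rewrite big_cons /= uP mxE.
Qed.

Lemma semialgebraic_definable n (A : set 'rV[R]_n) :
  semialgebraic A -> definable A.
Proof.
elim=> {A} [p|p|A _ [F FP]|A B _ [F FP] _ [G GP]|A B _ [F FP] _ [G GP]].
- have [t tP] := term_of_mpoly p.
  by exists (ord.Equal t (GRing.Const 0)) => e /=; rewrite tP.
- have [t tP] := term_of_mpoly p.
  by exists (ord.Lt (GRing.Const 0) t) => e /=; rewrite tP.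
- by exists (ord.Not F) => e /=; rewrite FP.
- by exists (ord.And F G) => e /=; rewrite FP GP.
- by exists (ord.Or F G) => e /=; rewrite FP GP.
Qed.

Definition row_env n (x : 'rV[R]_n) : seq R := [seq x 0 i | i <- enum 'I_n].

Lemma row_envK n (x : 'rV[R]_n) : env_row n (row_env x) = x.
Proof.
apply/rowP => i; rewrite mxE (nth_map i) ?size_enum_ord ?ltn_ord //.
by rewrite nth_ord_enum.
Qed.

Lemma mpoly_of_rterm n (t : GRing.term R) : GRing.rterm t ->
  exists p : mpoly n R, forall x : 'rV[R]_n,
    meval (x 0) p = GRing.eval (row_env x) t.
Proof.
elim: t => //=.
- move=> i _; have [lt_in|le_ni] := ltnP i n.
    exists (mpolyX R (mnm1 (Ordinal lt_in))) => x.
    by rewrite mevalXU -[in LHS](row_envK x) mxE.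
  by exists 0 => x; rewrite raddf0 nth_default // size_map size_enum_ord.
- by move=> c _; exists (mpolyC n c) => x; rewrite mevalC.
- by move=> k _; exists (mpolyC n k%:R) => x; rewrite mevalC.
- move=> t IHt u IHu /andP[/IHt[p pP] /IHu[q qP]].
  by exists (p + q) => x; rewrite mevalD pP qP.
- by move=> t IHt /IHt[p pP]; exists (- p) => x; rewrite mevalN pP.
- by move=> t IHt k /IHt[p pP]; exists (p *+ k) => x; rewrite mevalMn pP.
- move=> t IHt u IHu /andP[/IHt[p pP] /IHu[q qP]].
  by exists (p * q) => x; rewrite mevalM pP qP.
- by move=> t IHt k /IHt[p pP]; exists (p ^+ k) => x; rewrite rmorphXn /= pP.
Qed.

Lemma qf_semialgebraic n (F : ord.formula R) :
  ord.qf_form F -> ord.rformula F ->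
  semialgebraic [set x : 'rV[R]_n | ord.qf_eval (row_env x) F].
Proof.
elim: F => //=.
- move=> b _ _; suff -> : [set x : 'rV[R]_n | b] =
      if b then [set x : 'rV[R]_n | meval (x 0) (0 : mpoly n R) = 0]
      else [set x : 'rV[R]_n | 0 < meval (x 0) (0 : mpoly n R)].
    by case: b; constructor.
  by apply/seteqP; split=> x /=; case: b; rewrite /= raddf0 ?ltxx.
- move=> t u _ /andP[/(@mpoly_of_rterm n)[p pP] /(@mpoly_of_rterm n)[q qP]].
  rewrite [X in semialgebraic X](_ : _ = [set x : 'rV[R]_n | meval (x 0) (p - q) = 0]).
    by constructor.
  apply/seteqP; split=> x /=; rewrite mevalB pP qP.
    by move=> /eqP ->; rewrite subrr.
  by move=> /eqP; rewrite subr_eq0.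
- move=> t u _ /andP[/(@mpoly_of_rterm n)[p pP] /(@mpoly_of_rterm n)[q qP]].
  rewrite [X in semialgebraic X](_ : _ = [set x : 'rV[R]_n | 0 < meval (x 0) (q - p)]).
    by constructor.
  by apply/seteqP; split=> x /=; rewrite mevalB pP qP subr_gt0.
- move=> t u _ /andP[/(@mpoly_of_rterm n)[p pP] /(@mpoly_of_rterm n)[q qP]].
  rewrite [X in semialgebraic X](_ : _ = ~` [set x : 'rV[R]_n | 0 < meval (x 0) (p - q)]).
    by do 2 constructor.
  by apply/seteqP; split=> x /=; rewrite mevalB pP qP subr_gt0 leNgt => /negP.
- move=> F IHF G IHG /andP[qF qG] /andP[rF rG].
  rewrite [X in semialgebraic X](_ : _ =
    [set x : 'rV[R]_n | ord.qf_eval (row_env x) F] `&`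
    [set x : 'rV[R]_n | ord.qf_eval (row_env x) G]); first by constructor; auto.
  by apply/seteqP; split=> x /= /andP.
- move=> F IHF G IHG /andP[qF qG] /andP[rF rG].
  rewrite [X in semialgebraic X](_ : _ =
    [set x : 'rV[R]_n | ord.qf_eval (row_env x) F] `|`
    [set x : 'rV[R]_n | ord.qf_eval (row_env x) G]); first by constructor; auto.
  by apply/seteqP; split=> x /= /orP.
- move=> F IHF G IHG /andP[qF qG] /andP[rF rG].
  rewrite [X in semialgebraic X](_ : _ =
    ~` [set x : 'rV[R]_n | ord.qf_eval (row_env x) F] `|`
    [set x : 'rV[R]_n | ord.qf_eval (row_env x) G]).
    by constructor; first constructor; auto.
  apply/seteqP; split=> x /=; rewrite implybE.
    by move=> /orP[/negP|]; [left|right].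
  by move=> [/negP ->//|->]; rewrite orbT.
- move=> F IHF qF rF.
  rewrite [X in semialgebraic X](_ : _ =
    ~` [set x : 'rV[R]_n | ord.qf_eval (row_env x) F]); first by constructor; auto.
  by apply/seteqP; split=> x /= /negP.
Qed.

Lemma definable_semialgebraic n (A : set 'rV[R]_n) :
  definable A -> semialgebraic A.
Proof.
move=> [F FP].
pose G := ord.quantifier_elim (@wproj R) (ord.to_rform F).
have /andP[qG rG] : ord.qf_form G && ord.rformula G.
  apply: ord.quantifier_elim_wf; last exact: ord.to_rform_rformula.
  by move=> i bc; apply: wf_QE_wproj.
rewrite [X in semialgebraic X](_ : _ =
  [set x : 'rV[R]_n | ord.qf_eval (row_env x) G]); first exact: qf_semialgebraic.
apply/seteqP; split=> x /=.
  by rewrite -{1}(row_envK x) => /FP/rcf_satP.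
by move=> /rcf_satP/FP; rewrite row_envK.
Qed.

End Definable.

Section SemialgFun.
Variables (R : rcfType) (n : nat) (M : set 'rV[R]_n).
Implicit Types f g : M -> R.

Definition graph f : set 'rV[R]_(n + 1) :=
  [set row_mx (val x) (f x)%:M | x in [set: M]].

(** The open boxes generate the Euclidean topology. *)
Definition continuous_on f : Prop :=
  forall (x : M) (eps : R), 0 < eps -> exists2 delta : R, 0 < delta &
    forall y : M, (forall i, `|val y 0 i - val x 0 i| < delta) ->
      `|f y - f x| < eps.

Lemma definable_graphP f (F : ord.formula R) :
    (forall e, ord.holds e F <-> graph f (env_row (n + 1) e)) ->
  forall e y, ord.holds (set_nth 0 e n y) F <->
    exists2 x : M, val x = env_row n e & f x = y.
Proof.
move=> FP e y; rewrite FP.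
have -> : env_row (n + 1) (set_nth 0 e n y) = row_mx (env_row n e) y%:M.
  apply/rowP => i; rewrite !mxE nth_set_nth /=.
  case: (split_ordP i) => j ->; rewrite !mxE /=.
    by rewrite ltn_eqF.
  by rewrite !ord1 addn0 eqxx.
split=> [[x _]|[x xe fx]]; last by exists x => //; rewrite xe fx.
move=> /eq_row_mx[xe /matrixP/(_ 0 0)]; rewrite !mxE eqxx /= !mulr1n.
by exists x.
Qed.

Lemma semialg_graph_op (op : R -> R -> R)
    (T : GRing.term R -> GRing.term R -> GRing.term R) f g :
    (forall e t u, GRing.eval e (T t u) = op (GRing.eval e t) (GRing.eval e u)) ->
  semialgebraic (graph f) -> semialgebraic (graph g) ->
  semialgebraic (graph (fun x => op (f x) (g x))).
Proof.
move=> TP /semialgebraic_definable[F FP] /semialgebraic_definable[G GP].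
apply: definable_semialgebraic.
pose v i := GRing.Var R i.
pose Gz := ord.Exists n (ord.And G (ord.Equal (v n.+1) (T (v n.+2) (v n)))).
pose Fu := ord.Exists n (ord.And F
  (ord.Exists n.+2 (ord.And (ord.Equal (v n.+2) (v n)) Gz))).
exists (ord.Exists n.+1 (ord.And (ord.Equal (v n.+1) (v n)) Fu)) => e.
have env_set (e' : seq R) k y : (n <= k)%N ->
    env_row n (set_nth 0 e' k y) = env_row n e'.
  move=> le_nk; apply/rowP => i; rewrite !mxE nth_set_nth /=.
  by rewrite ltn_eqF // (leq_trans (ltn_ord i)).
have sE (e' : seq R) k y j :
    (set_nth 0 e' k y)`_j = if j == k then y else e'`_j.
  by rewrite nth_set_nth.
have n1 : (n.+1 == n) = false by rewrite gtn_eqF.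
have n2 : (n.+2 == n) = false by rewrite gtn_eqF // ltnW.
have n12 : (n.+1 == n.+2) = false by rewrite ltn_eqF.
have n01 : (n == n.+1) = false by rewrite ltn_eqF.
have n02 : (n == n.+2) = false by rewrite ltn_eqF // ltnW.
have nE := (n1, n2, n12, n01, n02, eqxx).
rewrite /= /graph /=; split.
- move=> [z [+ [u [/(definable_graphP FP)[x xe fx] [w [+ [y [+ +]]]]]]]].
  move=> + + /(definable_graphP GP)[x' x'e gx'].
  rewrite TP /= !(sE, nE) => zE wE zop.
  rewrite !env_set ?leqnn ?leqnSn ?(leqW (leqnSn n)) // in xe x'e.
  have xx' : x = x' by apply: val_inj; rewrite xe x'e.
  exists x => //; apply/rowP => i; rewrite !mxE.
  case: (split_ordP i) => j ->.
    by rewrite xe mxE.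
  by rewrite !ord1 mxE eqxx mulr1n /= addn0 -zE zop wE fx xx' gx'.
- move=> [x _ xe].
  have xn : val x = env_row n e.
    apply/rowP => i; have /rowP/(_ (lshift 1 i)) := xe.
    by rewrite row_mxEl !mxE.
  have en : op (f x) (g x) = e`_n.
    have /rowP/(_ (rshift n 0)) := xe.
    by rewrite row_mxEr !mxE /= addn0.
  exists e`_n; rewrite !(sE, nE); split=> //.
  exists (f x); split.
    by apply/(definable_graphP FP); exists x; rewrite ?env_set ?leqnn ?leqnSn ?(leqW (leqnSn n)).
  exists (f x); rewrite !(sE, nE); split=> //.
  exists (g x); split.
    by apply/(definable_graphP GP); exists x; rewrite ?env_set ?leqnn ?leqnSn ?(leqW (leqnSn n)).
  by rewrite TP /= !(sE, nE).
Qed.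

Lemma semialg_graph_cst c :
  semialgebraic M -> semialgebraic (graph (fun=> c)).
Proof.
move=> /semialgebraic_definable[F FP]; apply: definable_semialgebraic.
exists (ord.And F (ord.Equal (GRing.Var R n) (GRing.Const c))) => e /=.
rewrite FP; split=> [[Me en]|[x _ xe]].
  exists (exist _ (env_row n e) (mem_set Me)) => //=.
  apply/rowP => i; rewrite !mxE; case: (split_ordP i) => j ->.
    by rewrite mxE.
  by rewrite !ord1 mxE eqxx mulr1n /= addn0 en.
split.
  suff <- : val x = env_row n e by apply: set_mem (valP x).
  apply/rowP => i; have /rowP/(_ (lshift 1 i)) := xe.
  by rewrite row_mxEl !mxE.
have /rowP/(_ (rshift n 0)) := xe.
by rewrite row_mxEr !mxE /= addn0.
Qed.

Lemma continuous_cst c : continuous_on (fun=> c).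
Proof. by move=> x eps e0; exists 1 => // y _; rewrite subrr normr0. Qed.

Lemma continuous_sub f g :
  continuous_on f -> continuous_on g -> continuous_on (f - g).
Proof.
move=> fc gc x eps e0; have e20 : 0 < eps / 2 by rewrite divr_gt0.
have [d1 d10 fd] := fc x _ e20; have [d2 d20 gd] := gc x _ e20.
exists (Num.min d1 d2) => [|y yx]; first by rewrite lt_min d10.
have fy : `|f y - f x| < eps / 2.
  by apply: fd => i; have := yx i; rewrite lt_min => /andP[].
have gy : `|g y - g x| < eps / 2.
  by apply: gd => i; have := yx i; rewrite lt_min => /andP[].
have -> : (f - g) y - (f - g) x = (f y - f x) - (g y - g x).
  by rewrite -[LHS]/(f y - g y - (f x - g x)) !opprD !opprK addrACA.
by rewrite (le_lt_trans (ler_normB _ _)) // [ltRHS]splitr ltrD.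
Qed.

Lemma continuous_mul f g :
  continuous_on f -> continuous_on g -> continuous_on (f * g).
Proof.
move=> fc gc x eps e0.
pose a := eps / 2 / (`|g x| + 1); pose b := eps / 2 / (`|f x| + 1).
have gx0 : 0 < `|g x| + 1 by rewrite ltr_wpDl.
have fx0 : 0 < `|f x| + 1 by rewrite ltr_wpDl.
have a0 : 0 < Num.min 1 a by rewrite lt_min ltr01 !divr_gt0.
have b0 : 0 < b by rewrite !divr_gt0.
have [d1 d10 fd] := fc x _ a0; have [d2 d20 gd] := gc x _ b0.
exists (Num.min d1 d2) => [|y yx]; first by rewrite lt_min d10.
have /fd : forall i, `|val y 0 i - val x 0 i| < d1.
  by move=> i; have := yx i; rewrite lt_min => /andP[].
rewrite lt_min => /andP[fy1 fya].
have gy : `|g y - g x| < b.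
  by apply: gd => i; have := yx i; rewrite lt_min => /andP[].
have -> : (f * g) y - (f * g) x = f y * (g y - g x) + g x * (f y - f x).
  rewrite -[LHS]/(f y * g y - f x * g x) [in RHS]mulrBr [in RHS]mulrBr addrA [g x * f y]mulrC subrK.
  by rewrite [g x * f x]mulrC.
have fyle : `|f y| <= `|f x| + 1.
  rewrite -[f y](subrK (f x)) addrC (le_trans (ler_normD _ _)) //.
  by rewrite lerD2l ltW.
have le1 : `|f y * (g y - g x)| <= eps / 2.
  rewrite normrM (le_trans (ler_pM _ _ fyle (ltW gy))) //.
  by rewrite /b mulrC divfK ?gt_eqF.
have lt2 : `|g x * (f y - f x)| < eps / 2.
  rewrite normrM -[ltRHS](divfK (lt0r_neq0 gx0)) -/a mulrC.
  have : `|f y - f x| * `|g x| <= `|f y - f x| * (`|g x| + 1).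
    by rewrite ler_wpM2l // lerDl.
  by move=> /le_lt_trans; apply; rewrite ltr_pM2r.
by rewrite (le_lt_trans (ler_normD _ _)) // [ltRHS]splitr ler_ltD.
Qed.

End SemialgFun.

Section SemialgRing.
Variables (R : rcfType) (n : nat) (M : semialg_set R n).

Definition semialg_pred : {pred M -> R} :=
  fun f => `[< semialgebraic (graph f) /\ continuous_on f >].

Lemma semialg_pred_subring : subring_closed semialg_pred.
Proof.
split.
- apply/asboolP; split; last exact: continuous_cst.
  exact: semialg_graph_cst (semialg_setP M).
- move=> f g /asboolP[sf cf] /asboolP[sg cg]; apply/asboolP; split.
    exact: (@semialg_graph_op _ _ _ (fun a b => a - b)
             (fun t u => GRing.Add t (GRing.Opp u))).
  exact: continuous_sub.
- move=> f g /asboolP[sf cf] /asboolP[sg cg]; apply/asboolP; split.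
    exact: (@semialg_graph_op _ _ _ *%R (@GRing.Mul R)).
  exact: continuous_mul.
Qed.
HB.instance Definition _ :=
  GRing.isSubringClosed.Build (M -> R) semialg_pred semialg_pred_subring.

(** [semialg_fun] is S(M), and [bsemialg_fun] below is S*(M). *)
Record semialg_fun := SemialgFun {
  semialg_val :> M -> R;
  semialg_funP : semialg_val \in semialg_pred }.

HB.instance Definition _ := [isSub for semialg_val].
HB.instance Definition _ := [Choice of semialg_fun by <:].
HB.instance Definition _ :=
  GRing.SubChoice_isSubComPzRing.Build _ _ semialg_fun (subringClosedP _).

Definition bounded_pred : {pred semialg_fun} :=
  fun f => `[< exists c, forall x, `|f x| <= c >].

Lemma bounded_pred_subring : subring_closed bounded_pred.
Proof.
split.
- by apply/asboolP; exists 1 => x; rewrite normr1.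
- move=> f g /asboolP[a fa] /asboolP[b gb]; apply/asboolP; exists (a + b) => x.
  by rewrite (le_trans (ler_normB _ _)) // lerD.
- move=> f g /asboolP[a fa] /asboolP[b gb]; apply/asboolP; exists (a * b) => x.
  by rewrite normrM ler_pM.
Qed.
HB.instance Definition _ :=
  GRing.isSubringClosed.Build semialg_fun bounded_pred bounded_pred_subring.

Record bsemialg_fun := BSemialgFun {
  bsemialg_val :> semialg_fun;
  bsemialg_funP : bsemialg_val \in bounded_pred }.

HB.instance Definition _ := [isSub for bsemialg_val].
HB.instance Definition _ := [Choice of bsemialg_fun by <:].
HB.instance Definition _ :=
  GRing.SubChoice_isSubComPzRing.Build _ _ bsemialg_fun (subringClosedP _).

Lemma semialg_cst_subproof (c : R) : (fun=> c) \in semialg_pred.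
Proof.
apply/asboolP; split; last exact: continuous_cst.
exact: semialg_graph_cst (semialg_setP M).
Qed.

Definition semialg_cst (c : R) : semialg_fun :=
  SemialgFun (semialg_cst_subproof c).

Lemma semialg_cst_zmod : zmod_morphism semialg_cst.
Proof. by move=> a b; apply: val_inj. Qed.
Lemma semialg_cst_monoid : monoid_morphism semialg_cst.
Proof. by split=> [|a b]; apply: val_inj. Qed.
HB.instance Definition _ :=
  GRing.isZmodMorphism.Build R semialg_fun semialg_cst semialg_cst_zmod.
HB.instance Definition _ :=
  GRing.isMonoidMorphism.Build R semialg_fun semialg_cst semialg_cst_monoid.

Lemma bsemialg_cst_subproof (c : R) : semialg_cst c \in bounded_pred.
Proof. by apply/asboolP; exists `|c|. Qed.

Definition bsemialg_cst (c : R) : bsemialg_fun :=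
  BSemialgFun (bsemialg_cst_subproof c).

Lemma bsemialg_cst_zmod : zmod_morphism bsemialg_cst.
Proof. by move=> a b; do 2 apply: val_inj. Qed.
Lemma bsemialg_cst_monoid : monoid_morphism bsemialg_cst.
Proof. by split=> [|a b]; do 2 apply: val_inj. Qed.
HB.instance Definition _ :=
  GRing.isZmodMorphism.Build R bsemialg_fun bsemialg_cst bsemialg_cst_zmod.
HB.instance Definition _ :=
  GRing.isMonoidMorphism.Build R bsemialg_fun bsemialg_cst bsemialg_cst_monoid.

Definition zeros (f : semialg_fun) : set 'rV[R]_n :=
  [set val x | x in [set x : M | f x = 0]].

End SemialgRing.

Record prime_ideal (A : comPzRingType) := PrimeIdeal {
  prime_carrier :> set A;
  prime_ideal0 : prime_carrier 0;
  prime_idealD : forall a b,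
    prime_carrier a -> prime_carrier b -> prime_carrier (a + b);
  prime_idealMl : forall a b, prime_carrier b -> prime_carrier (a * b);
  prime_ideal1 : ~ prime_carrier 1;
  prime_idealM : forall a b,
    prime_carrier (a * b) -> prime_carrier a \/ prime_carrier b }.

(** [A] itself, which is nontrivial since it has the proper ideal [p]; the
    quotient rings of the library require a nontrivial base ring. *)
Definition prime_base (A : comPzRingType) (p : prime_ideal A) : Type := A.

Section ResidueField.
Local Open Scope quotient_scope.
Variables (A : comPzRingType) (p : prime_ideal A).

HB.instance Definition _ := GRing.ComPzRing.copy (prime_base p) A.

Lemma prime_base1_neq0 : (1 : prime_base p) != 0.
Proof.
apply/eqP => e10; apply: (@prime_ideal1 _ p).
by have := @prime_ideal0 _ p; rewrite -[0]e10.
Qed.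
HB.instance Definition _ :=
  GRing.PzSemiRing_isNonZero.Build (prime_base p) prime_base1_neq0.

Definition prime_pred : prime_base p -> bool := fun a => `[< prime_carrier p a >].

Lemma prime_pred_idealr : idealr_closed prime_pred.
Proof.
split.
- by apply/asboolP; apply: prime_ideal0.
- by apply/negP => /asboolP; apply: prime_ideal1.
- move=> a u v /asboolP pu /asboolP pv; apply/asboolP.
  by apply: prime_idealD => //; apply: prime_idealMl.
Qed.
HB.instance Definition _ :=
  isIdealr.Build (prime_base p) prime_pred prime_pred_idealr.

Lemma prime_pred_prime : prime_idealr_closed prime_pred.
Proof.
by move=> a b /asboolP/prime_idealM[] ab; apply/orP; [left|right];
  apply/asboolP.
Qed.
HB.instance Definition _ :=
  isPrimeIdealrClosed.Build (prime_base p) prime_pred prime_pred_prime.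
Definition prime_idl : prime_idealr (prime_base p) := prime_pred.

(** The domain A/p; the library does not give its units. *)
Definition prime_quot : Type := {ideal_quot prime_idl}.
HB.instance Definition _ := GRing.ComNzRing.on prime_quot.

Definition prime_quot_unit : pred prime_quot :=
  fun x => `[< exists y, y * x = 1 >].
Definition prime_quot_inv (x : prime_quot) : prime_quot :=
  if pselect (exists y, y * x = 1) is left ex_y then projT1 (cid ex_y) else x.

Lemma prime_quot_mulVr : {in prime_quot_unit, left_inverse 1 prime_quot_inv *%R}.
Proof.
move=> x /asboolP xU; rewrite /prime_quot_inv.
by case: pselect => // ex_y; case: cid.
Qed.
Lemma prime_quot_unitP x y : y * x = 1 -> prime_quot_unit x.
Proof. by move=> yx; apply/asboolP; exists y. Qed.
Lemma prime_quot_inv_out : {in [predC prime_quot_unit], prime_quot_inv =1 id}.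
Proof.
move=> x /asboolP xU; rewrite /prime_quot_inv.
by case: pselect.
Qed.
HB.instance Definition _ := GRing.ComNzRing_hasMulInverse.Build prime_quot
  prime_quot_mulVr prime_quot_unitP prime_quot_inv_out.

Lemma prime_quot_idomain (x y : prime_quot) :
  x * y = 0 -> (x == 0) || (y == 0).
Proof. exact: Quotient.rquot_IdomainAxiom. Qed.
HB.instance Definition _ :=
  GRing.ComUnitRing_isIntegral.Build prime_quot prime_quot_idomain.

Definition prime_proj (a : A) : prime_quot := \pi_({ideal_quot prime_idl}) a.

Lemma prime_proj_zmod : zmod_morphism prime_proj.
Proof.
exact: (rmorphB (\pi_({ideal_quot prime_idl}) :
  {rmorphism prime_base p -> {ideal_quot prime_idl}})).
Qed.
Lemma prime_proj_monoid : monoid_morphism prime_proj.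
Proof.
split; first exact: (rmorph1 (\pi_({ideal_quot prime_idl}) :
  {rmorphism prime_base p -> {ideal_quot prime_idl}})).
exact: (rmorphM (\pi_({ideal_quot prime_idl}) :
  {rmorphism prime_base p -> {ideal_quot prime_idl}})).
Qed.
HB.instance Definition _ :=
  GRing.isZmodMorphism.Build A prime_quot prime_proj prime_proj_zmod.
HB.instance Definition _ :=
  GRing.isMonoidMorphism.Build A prime_quot prime_proj prime_proj_monoid.

Definition residue_field : fieldType := {fraction prime_quot}.

Definition residue_map : {rmorphism A -> residue_field} :=
  (@tofrac prime_quot) \o prime_proj.

End ResidueField.

(** With values in the extended integers: [+oo] if [P] is unbounded, and [-oo]
    if [P] is empty, so that the zero ring and the empty set have dimension
    [-oo]. *)

Definition sup_nat (P : nat -> Prop) : \bar int :=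
  supremum -oo%E [set k%:Z%:E | k in P].

Definition krull_dim (A : comPzRingType) : \bar int :=
  sup_nat (fun k => exists P : 'I_k.+1 -> prime_ideal A,
    forall i j : 'I_k.+1, (i < j)%N -> P i `<` P j).

Definition alg_indep (k : fieldType) (K : fieldType) (iota : {rmorphism k -> K})
    m (x : 'I_m -> K) : Prop :=
  forall P : mpoly m k, mmap iota x P = 0 -> P = 0.

Definition trdeg (k K : fieldType) (iota : {rmorphism k -> K}) : \bar int :=
  sup_nat (fun m => exists x : 'I_m -> K, alg_indep iota x).

Section SemialgDim.
Variables (R : rcfType) (n : nat) (A : set 'rV[R]_n).

Definition poly_pred : {pred A -> R} :=
  fun f => `[< exists p : mpoly n R, forall x, f x = meval (val x 0) p >].

Lemma poly_pred_subring : subring_closed poly_pred.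
Proof.
split.
- by apply/asboolP; exists 1 => x; rewrite meval1.
- move=> f g /asboolP[p fp] /asboolP[q gq]; apply/asboolP; exists (p - q) => x.
  by rewrite mevalB -fp -gq.
- move=> f g /asboolP[p fp] /asboolP[q gq]; apply/asboolP; exists (p * q) => x.
  by rewrite mevalM -fp -gq.
Qed.
HB.instance Definition _ :=
  GRing.isSubringClosed.Build (A -> R) poly_pred poly_pred_subring.

(** The ring of polynomial functions on [A], isomorphic to the quotient of
    R[X_0, ..., X_(n-1)] by the ideal of [A]: it is the coordinate ring of the
    Zariski closure of [A]. *)
Record poly_fun := PolyFun {
  poly_val :> A -> R;
  poly_funP : poly_val \in poly_pred }.

HB.instance Definition _ := [isSub for poly_val].
HB.instance Definition _ := [Choice of poly_fun by <:].
HB.instance Definition _ :=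
  GRing.SubChoice_isSubComPzRing.Build _ _ poly_fun (subringClosedP _).

Definition semialg_dim : \bar int := krull_dim poly_fun.

End SemialgDim.

Section Invariants.
Variables (R : rcfType) (n : nat) (M : semialg_set R n).

Definition z_ideal (I : set (semialg_fun M)) : Prop :=
  forall f g, I f -> zeros f `<=` zeros g -> I g.

(** The infimum is a minimum: the values are in {-oo} U nat U {+oo}, and the
    set of values is not empty since [p] contains 0. *)
Definition semialg_depth (p : prime_ideal (semialg_fun M)) : \bar int :=
  infimum +oo%E [set semialg_dim (zeros f) | f in p].

Definition semialg_residue_cst (p : prime_ideal (semialg_fun M)) :
    {rmorphism R -> residue_field p} :=
  residue_map p \o @semialg_cst R n M.

Definition bsemialg_residue_cst (p : prime_ideal (bsemialg_fun M)) :
    {rmorphism R -> residue_field p} :=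
  residue_map p \o @bsemialg_cst R n M.

End Invariants.

(* Main.v *)
From HB Require Import structures.
Require Import Defs.
From mathcomp Require Import all_boot all_order all_algebra.
From mathcomp Require Import boolp classical_sets functions constructive_ereal.
From mathcomp Require Import polyrcf.
From mathcomp Require Import ring lra zify.
From mathcomp Require mpoly ordered_qelim.
Import -(notations) mpoly.

Set Implicit Arguments.
Unset Strict Implicit.
Unset Printing Implicit Defensive.

Import Order.TTheory GRing.Theory Num.Theory.

Local Open Scope ring_scope.

(** A semialgebraic function f satisfies, at every point x, an equation
    G(x, f(x)) = 0 for one of finitely many polynomials G(X, T) with G(x, T) not
    identically zero: otherwise the signs that describe the graph of f would not
    change near f(x) on the vertical line over x, and the graph would contain a
    segment of that line ([semialg_piecewise_algebraic]).

    Such functions can be no more independent than the coordinates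
    ([piecewise_dependent]): if any k coordinate functions satisfy a polynomial
    relation on the set, so do any k functions of this kind.  This is proved by
    counting, so that no irreducible components appear.  The relations between
    coordinates allow one to rewrite every polynomial in standard monomials,
    of which only O(t^(k-1)) have degree at most t; where the leading
    coefficient of G does not vanish, a power of it brings the powers of f back
    to bounded exponents.  Hence the (t+1)^k monomials with exponents at most t
    in k such functions become linearly dependent for large t.

    (i) Elements of the residue field are quotients a/b of semialgebraic
    functions, and the pointwise quotient is a semialgebraic, possibly
    discontinuous, function.  So k algebraically independent elements of the
    residue field give k independent coordinates on M: with a relation between
    the functions a/b, multiplied by powers of the denominators, one gets an
    element that is zero, hence in the prime ideal.  It remains to find a chain
    of k+1 primes in the ring of polynomial functions on M when k coordinates
    are independent ([independent_coordinates_dim]): take independent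
    coordinates in the largest possible number, so that the others are algebraic
    over them, and lift a chain of coordinate subspaces through a point where
    the extension is integral, as in the going-up theorem
    ([chain_of_independent]).

    (ii) Let p be a prime z-ideal.  For f in p, functions that vanish on Z(f)
    belong to p, so the argument of (i) works on Z(f), and the transcendence
    degree is at most dim Z(f).  For the converse, let f be the sum of the
    squares of one relation in p for each family of coordinates that has one.
    A chain of primes of length k in the ring of polynomial functions on Z(f)
    produces k independent polynomial functions ([chain_independent]), hence k
    independent coordinates on Z(f); these are independent modulo p by the
    choice of f, so k is at most the transcendence degree. *)

(** * Polynomials in several variables *)

Section Univariate.
Variables (K : fieldType) (N n : nat) (sp : 'I_N -> option 'I_n).

(** [sp] sends the distinguished variable to [None] and numbers the others. *)
Definition univariate (p : mpoly N K) : {poly mpoly n K} :=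
  mmap (polyC \o @mpolyC n K)
    (fun i => if sp i is Some j then (mpolyX K (mnm1 j))%:P else 'X) p.

Lemma horner_univariate p v t :
  (map_poly (meval v) (univariate p)).[t] =
  meval (fun i => if sp i is Some j then v j else t) p.
Proof.
rewrite /univariate /mmap rmorph_sum horner_sum mevalE.
apply: eq_bigr => m _; rewrite rmorphM hornerM /= map_polyC hornerC /= mevalC.
congr (_ * _); rewrite /mmap1 rmorph_prod horner_prod; apply: eq_bigr => i _.
rewrite rmorphXn horner_exp /=; congr (_ ^+ _).
case: (sp i) => [j|]; first by rewrite map_polyC hornerC /= mevalXU.
by rewrite map_polyX hornerX.
Qed.

Lemma univariate_neq0 (sp' : option 'I_n -> 'I_N) (p : mpoly N K) :
  cancel sp sp' -> p != 0 -> univariate p != 0.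
Proof.
move=> spK; apply: contraNneq => p0.
have [r rC rX] : exists2 r : {rmorphism mpoly n K -> mpoly N K},
    forall c, r (mpolyC n c) = mpolyC N c
  & forall j, r (mpolyX K (mnm1 j)) = mpolyX K (mnm1 (sp' (Some j))).
  exists (mmap (@mpolyC N K) (fun j => mpolyX K (mnm1 (sp' (Some j))))).
    by move=> c; rewrite /= mmapC.
  by move=> j; rewrite /= mmapX mmap1U.
pose back (q : {poly mpoly n K}) : mpoly N K :=
  (map_poly r q).[mpolyX K (mnm1 (sp' None))].
suff <- : back (univariate p) = p by rewrite p0 /back rmorph0 horner0.
have backM : {morph back : q q' / q * q'}.
  by move=> q q'; rewrite /back rmorphM hornerM.
have back1 : back 1 = 1 by rewrite /back rmorph1 hornerC.
have backC c : back (mpolyC n c)%:P = mpolyC N c.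
  by rewrite /back map_polyC hornerC /= rC.
have backX i : back (if sp i is Some j then (mpolyX K (mnm1 j))%:P else 'X) =
    mpolyX K (mnm1 i).
  rewrite -{2}[i]spK /back; case: (sp i) => [j|].
    by rewrite map_polyC hornerC /= rX.
  by rewrite map_polyX hornerX.
have back_sum I (s : seq I) (F : I -> {poly mpoly n K}) :
    back (\sum_(i <- s) F i) = \sum_(i <- s) back (F i).
  by rewrite /back rmorph_sum horner_sum.
rewrite /univariate /mmap back_sum [RHS]mpolyE.
apply: eq_bigr => m _; rewrite backM backC mul_mpolyC; congr (_ *: _).
rewrite /mmap1 (big_morph back backM back1) mpolyXE_id.
apply: eq_bigr => i _; rewrite -backX; elim: (m i) => [|e IHe].
  by rewrite !expr0.
by rewrite !exprS backM IHe.
Qed.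

End Univariate.

Lemma poly_nonroot (R : numFieldType) (q : {poly R}) :
  q != 0 -> exists t, q.[t] != 0.
Proof.
move=> q0; apply: contrapT => /forallNP qt.
have := @max_poly_roots _ q [seq i%:R | i <- iota 0 (size q)] q0.
rewrite size_map size_iota ltnn => qN; apply: notF; apply: qN.
  by apply/allP => t _; apply/rootP/eqP; apply: contra_notT (qt t).
by rewrite map_inj_uniq ?iota_uniq // => i j /eqP; rewrite eqr_nat => /eqP.
Qed.

Lemma mpoly_nonroot (R : numFieldType) m (s : mpoly m R) :
  s != 0 -> exists c, meval c s != 0.
Proof.
elim: m s => [|m IHm] s s0.
  exists (fun=> 0); rewrite [s]nvar0_mpolyC mevalC; apply: contraNneq s0 => s0.
  by rewrite [s]nvar0_mpolyC s0 mpolyC0.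
have spK : cancel (unlift ord_max) (oapp (lift ord_max) (@ord_max m)).
  by move=> i; case: unliftP.
have us0 := univariate_neq0 spK s0.
have [v va] : exists v, meval v (lead_coef (univariate (unlift ord_max) s)) != 0.
  by apply: IHm; rewrite lead_coef_eq0.
have [|t ht] := @poly_nonroot _ (map_poly (meval v) (univariate (unlift ord_max) s)).
  by apply: contraNneq va => s1; rewrite -coef_map s1 coef0.
exists (fun i => if unlift ord_max i is Some j then v j else t).
by rewrite -horner_univariate.
Qed.

Lemma meval_mmap (K : comNzRingType) k n (h : 'I_k -> mpoly n K)
    (v : 'I_n -> K) (p : mpoly k K) :
  meval v (mmap (@mpolyC n K) h p) = meval (fun i => meval v (h i)) p.
Proof.
rewrite /mmap raddf_sum /= mevalE; apply: eq_bigr => m _.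
rewrite mevalM mevalC /mmap1 rmorph_prod; congr (_ * _).
by apply: eq_bigr => i _; rewrite rmorphXn.
Qed.

Section Rename.
Variables (K : fieldType) (k n : nat) (g : 'I_k -> 'I_n).

Definition mrename (p : mpoly k K) : mpoly n K :=
  mmap (@mpolyC n K) (fun i => mpolyX K (mnm1 (g i))) p.

Lemma meval_mrename v p : meval v (mrename p) = meval (v \o g) p.
Proof.
rewrite meval_mmap; apply: meval_eq => i; exact: mevalXU.
Qed.

Hypothesis g_inj : injective g.

Lemma mrename_neq0 p : p != 0 -> mrename p != 0.
Proof.
apply: contraNneq => p0.
pose h j : mpoly k K := oapp (fun i => mpolyX K (mnm1 i)) 0 [pick i | g i == j].
have hg i : h (g i) = mpolyX K (mnm1 i).
  rewrite /h; case: pickP => [i' /eqP/g_inj -> //|/(_ i)].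
  by rewrite eqxx.
have hK q : mmap (@mpolyC k K) h (mrename q) = q.
  rewrite {1}/mrename {2}/mmap raddf_sum /= [RHS]mpolyE.
  apply: eq_bigr => m _; rewrite rmorphM /= mmapC mul_mpolyC; congr (_ *: _).
  rewrite /mmap1 rmorph_prod /= mpolyXE_id; apply: eq_bigr => i _.
  by rewrite rmorphXn /= mmapX mmap1U hg.
by rewrite -(hK p) p0 raddf0.
Qed.

Lemma mrename_supp p m : m \in msupp (mrename p) ->
  forall j, (forall i, g i != j) -> m j = 0%N.
Proof.
move=> + j gj; rewrite /mrename /mmap => /msupp_sum_le/flattenP[s].
move=> /mapP[m' _ ->]; rewrite mul_mpolyC => /msuppZ_le.
rewrite /mmap1; under eq_bigr do rewrite mpolyXn.
rewrite mprodXE msuppX inE => /eqP ->.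
rewrite mnm_sumE big1 // => i _; rewrite mulmnE mnm1E.
by rewrite (negPf (gj i)).
Qed.

End Rename.

(** * Spanning families of functions *)

Section Span.
Variables (K : fieldType) (T : Type).

Definition spanned (W : finType) (b : W -> T -> K) (u : T -> K) : Prop :=
  exists c : W -> K, forall x, u x = \sum_w c w * b w x.

Lemma spanned_gen (W : finType) (b : W -> T -> K) w u :
  (forall x, u x = b w x) -> spanned b u.
Proof.
move=> uE; exists (fun w' => (w' == w)%:R) => x.
rewrite (bigD1 w) //= eqxx mul1r big1 ?addr0 ?uE // => i /negPf ->.
by rewrite mul0r.
Qed.

Lemma spanned_sum (W : finType) (b : W -> T -> K) I (r : seq I)
    (c : I -> K) (v : I -> T -> K) u :
  (forall i, spanned b (v i)) ->
  (forall x, u x = \sum_(i <- r) c i * v i x) -> spanned b u.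
Proof.
move=> vb uE; have /choice[a aE] := vb.
exists (fun w => \sum_(i <- r) c i * a i w) => x; rewrite uE.
under [RHS]eq_bigr do rewrite mulr_suml.
rewrite exchange_big /=; apply: eq_bigr => i _; rewrite aE mulr_sumr.
by apply: eq_bigr => w _; rewrite mulrA.
Qed.

Lemma spanned_dependent (W E : finType) (b : W -> T -> K) (v : E -> T -> K) :
  (#|W| < #|E|)%N -> (forall e, spanned b (v e)) ->
  exists2 c : E -> K, (exists e, c e != 0) & forall x, \sum_e c e * v e x = 0.
Proof.
move=> WE /choice[a aE].
pose A := \matrix_(i < #|E|, j < #|W|) a (enum_val i) (enum_val j).
have : kermx A != 0.
  rewrite -mxrank_eq0 mxrank_ker subn_eq0 -ltnNge.
  exact: leq_ltn_trans (rank_leq_col A) WE.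
move=> /rowV0Pn[r /sub_kermxP rA /rV0Pn[j rj]].
exists (fun e => r 0 (enum_rank e)); first by exists (enum_val j); rewrite enum_valK.
move=> x; under eq_bigr do rewrite aE mulr_sumr.
rewrite exchange_big /= big1 // => w _.
under eq_bigr do rewrite mulrA.
rewrite -mulr_suml; suff -> : \sum_e r 0 (enum_rank e) * a e w = 0 by rewrite mul0r.
have := congr1 (fun A : 'rV_#|W| => A 0 (enum_rank w)) rA; rewrite !mxE => rA0.
rewrite -[RHS]rA0.
rewrite [RHS](reindex (@enum_rank E)) /=; last exact/onW_bij/enum_rank_bij.
by apply: eq_bigr => e _; rewrite !mxE !enum_rankK.
Qed.

End Span.

(** * Standard monomials *)

Definition mdeg_le (K : nzRingType) n (s : nat) (p : mpoly n K) :=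
  forall m, m \in msupp p -> (mdeg m <= s)%N.

Section MdegLe.
Variables (K : fieldType) (n : nat).
Implicit Types p q : mpoly n K.

Lemma mdeg_leW s t p : (s <= t)%N -> mdeg_le s p -> mdeg_le t p.
Proof. by move=> st ps m /ps /leq_trans; apply. Qed.

Lemma mdeg_le0 s : mdeg_le s (0 : mpoly n K).
Proof. by move=> m; rewrite msupp0. Qed.

Lemma mdeg_leD s p q : mdeg_le s p -> mdeg_le s q -> mdeg_le s (p + q).
Proof. by move=> ps qs m /msuppD_le; rewrite mem_cat => /orP[/ps|/qs]. Qed.

Lemma mdeg_leN s p : mdeg_le s p -> mdeg_le s (- p).
Proof. by move=> ps m; rewrite (perm_mem (msuppN p)) => /ps. Qed.

Lemma mdeg_leM s t p q : mdeg_le s p -> mdeg_le t q -> mdeg_le (s + t) (p * q).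
Proof.
move=> ps qt m /msuppM_le /allpairsP[[m1 m2] /= [/ps m1s /qt m2t ->]].
by rewrite mdegD leq_add.
Qed.

Lemma mdeg_le_prod I (r : seq I) s (p : I -> mpoly n K) :
  (forall i, mdeg_le s (p i)) -> mdeg_le (size r * s) (\prod_(i <- r) p i).
Proof.
move=> ps; elim: r => [|i r IHr] /=.
  by rewrite big_nil => m; rewrite msupp1 inE => /eqP ->; rewrite mdeg0.
by rewrite big_cons mulSn; apply: mdeg_leM.
Qed.

Lemma mdeg_leX s p e : mdeg_le s p -> mdeg_le (e * s) (p ^+ e).
Proof.
move=> ps; have := @mdeg_le_prod _ (iota 0 e) s (fun=> p) (fun=> ps).
by rewrite size_iota big_const_seq count_predT size_iota -Monoid.iteropE.
Qed.

Lemma mdeg_le_msize p : mdeg_le (msize p) p.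
Proof. by move=> m /msize_mdeg_lt /ltnW. Qed.

End MdegLe.

Section Standard.
Variables (K : fieldType) (k n : nat) (T : Type) (x : T -> 'I_n -> K).

(** Related coordinates make the exponents of a monomial reducible as soon as
    k of them are large; standard monomials are those left over. *)
Definition standard (D : nat) (m : multinom n) : Prop :=
  forall g : 'I_k -> 'I_n, injective g -> exists i, (m (g i) < D)%N.

Hypothesis rel : forall g : 'I_k -> 'I_n, injective g ->
  exists2 F : mpoly k K, F != 0 & forall t, meval (x t \o g) F = 0.

(** There are finitely many families of k coordinates, so one D bounds the
    exponents in all the relations. *)
Lemma vanishing_rename : exists D : nat,
  forall g : 'I_k -> 'I_n, injective g -> exists F : mpoly n K,
    [/\ F != 0, forall t, meval (x t) F = 0,
        (forall m, m \in msupp F -> forall j, (forall i, g i != j) -> m j = 0%N)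
      & forall m, m \in msupp F -> forall j, (m j < D)%N].
Proof.
have /choice[F FP] : forall g : {ffun 'I_k -> 'I_n}, exists F : mpoly n K,
    injective g ->
    [/\ F != 0, forall t, meval (x t) F = 0
      & forall m, m \in msupp F -> forall j, (forall i, g i != j) -> m j = 0%N].
  move=> g; have [g_inj|g_ninj] := pselect (injective g); last by exists 0.
  have [F F0 Fx] := rel g_inj; exists (mrename g F) => _; split.
  - exact: mrename_neq0.
  - by move=> t; rewrite meval_mrename.
  - exact: mrename_supp.
exists (\max_g msize (F g))%N => g g_inj.
have fgE : finfun g =1 g by move=> i; rewrite ffunE.
have fg_inj : injective (finfun g) by move=> i j; rewrite !fgE => /g_inj.
have [F0 Fx Fs] := FP _ fg_inj; exists (F (finfun g)); split=> //.
  by move=> m mF j gj; apply: (Fs m mF) => i; rewrite fgE.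
move=> m mF j; apply: leq_trans (leq_bigmax (finfun g)).
apply: leq_ltn_trans (msize_mdeg_lt mF).
by rewrite mdegE (bigD1 j) //= leq_addr.
Qed.

Lemma mlead_sub_lt (p q : mpoly n K) : p != 0 -> q != 0 -> mlead p = mlead q ->
  let r := p - (mleadc p / mleadc q) *: q in r = 0 \/ (mlead r < mlead p)%O.
Proof.
move=> p0 q0 pq r; have [->|r0] := eqVneq r 0; [by left|right].
rewrite lt_neqAle; apply/andP; split.
  apply: contraNneq r0 => rp; rewrite -mleadc_eq0 rp /r mcoeffB mcoeffZ.
  by rewrite {3}pq divfK ?subrr // mleadc_eq0.
apply: le_trans (mleadB_le _ _) _; rewrite leUx lexx /=.
by rewrite pq; exact: mleadZ_le.
Qed.

(** Division by the relations, on leading monomials.  The monomial order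
    compares degrees first, so the degree does not increase: this is what makes
    the count of standard monomials effective. *)
Lemma standard_form : exists D : nat, forall p : mpoly n K,
  exists q : mpoly n K,
    [/\ forall t, meval (x t) q = meval (x t) p,
        forall s, mdeg_le s p -> mdeg_le s q
      & forall m, m \in msupp q -> standard D m].
Proof.
have [D FP] := vanishing_rename; exists D.
elim/mleadrect=> p IHp; have [->|p0] := eqVneq p 0.
  by exists 0; split=> // m; rewrite msupp0.
have lp_le s : mdeg_le s p -> (mdeg (mlead p) <= s)%N.
  by apply; exact: mlead_supp.
(* Cancel the leading term of p by h: a standard h is kept in the result, and
   a vanishing h changes no value. *)
suff [h [h0 hp hs [hx|hst]]] : exists h : mpoly n K,
    [/\ h != 0, mlead h = mlead p, mdeg_le (mdeg (mlead p)) h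
      & (forall t, meval (x t) h = 0) \/ (forall m, m \in msupp h -> standard D m)].
- have /= := mlead_sub_lt p0 h0 (esym hp); set c := (_ / _); case=> [r0|/IHp].
    exists 0; split; [|by move=> *; exact: mdeg_le0|by move=> m; rewrite msupp0].
    by move=> t; rewrite raddf0 -[p](subrK (c *: h)) r0 add0r mevalZ hx mulr0.
  move=> [q [qx qs qst]]; exists q; split=> // [t|s ps].
    by rewrite qx mevalB mevalZ hx mulr0 subr0.
  apply: qs; apply: mdeg_leD => //; apply: mdeg_leN => m /msuppZ_le.
  exact: (mdeg_leW (lp_le _ ps)).
- have /= := mlead_sub_lt p0 h0 (esym hp); set c := (_ / _); case=> [r0|/IHp].
    have pE : p = c *: h by apply/eqP; rewrite -subr_eq0; apply/eqP.
    by exists p; split=> // m; rewrite {1}pE => /msuppZ_le/hst.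
  move=> [q [qx qs qst]]; exists (q + c *: h); split=> [t|s ps|m].
  + by rewrite mevalD qx -mevalD subrK.
  + have hs' : mdeg_le s (c *: h).
      by move=> m /msuppZ_le; exact: (mdeg_leW (lp_le _ ps)).
    by apply: mdeg_leD => //; apply/qs/mdeg_leD => //; apply: mdeg_leN.
  + by move=> /msuppD_le; rewrite mem_cat => /orP[/qst //|/msuppZ_le/hst].
have [st|] := pselect (standard D (mlead p)).
  exists (mpolyX K (mlead p)); split.
  - by rewrite -msize_poly_eq0 msizeX.
  - by rewrite mleadXm.
  - by move=> m; rewrite msuppX inE => /eqP ->.
  - by right=> m; rewrite msuppX inE => /eqP ->.
move=> /existsNP[g /not_implyP[g_inj /forallNP gD]].
have [F [F0 Fx Fg FD]] := FP _ g_inj.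
(* The exponents of p on the k coordinates are at least D, and those of the
   relation F are less than D and supported there. *)
have leF : lem (mlead F) (mlead p).
  apply/mnm_lepP => j; have [[i <-]|/forallNP gj] := pselect (exists i, g i = j).
    apply: leq_trans (ltnW (FD _ (mlead_supp F0) _)) _.
    by rewrite leqNgt; apply/negP/gD.
  by rewrite (Fg _ (mlead_supp F0)) // => i; apply/eqP/gj.
exists (mpolyX K (mnm_sub (mlead p) (mlead F)) * F).
have X0 : mpolyX K (mnm_sub (mlead p) (mlead F)) != 0.
  by rewrite -msize_poly_eq0 msizeX.
have lE : mlead (mpolyX K (mnm_sub (mlead p) (mlead F)) * F) = mlead p.
  by rewrite mleadM // mleadXm submK.
split=> //; first by rewrite mulf_neq0.
  by move=> m /msize_mdeg_lt; rewrite -mlead_deg ?mulf_neq0 // lE.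
by left=> t; rewrite mevalM Fx mulr0.
Qed.

End Standard.

Section Count.
Variables (K : fieldType) (k n D : nat) (T : Type) (x : T -> 'I_n -> K).

(** A standard monomial has at most k exponents that are not less than D.  In a
    code, a coordinate carries an exponent less than D or points to one of k
    slots, which hold exponents at most s; so the number of codes grows like
    s^k.  Different codes may give the same monomial. *)
Definition std_code (s : nat) : finType :=
  ({ffun 'I_n -> 'I_k + 'I_D} * {ffun 'I_k -> 'I_s.+1})%type.

Definition std_exp s (w : std_code s) (j : 'I_n) : nat :=
  match w.1 j with inl i => w.2 i | inr d => d end.

Definition std_fun s (w : std_code s) (t : T) : K :=
  \prod_j x t j ^+ std_exp w j.

Lemma card_std_code s : #|std_code s| = ((k + D) ^ n * s.+1 ^ k)%N.
Proof. by rewrite card_prod !card_ffun card_sum !card_ord. Qed.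

Lemma std_code_exists s (m : multinom n) : standard k.+1 D m ->
  (mdeg m <= s)%N -> exists w : std_code s, std_exp w =1 m.
Proof.
move=> mst ms; pose L := [pred j | (D <= m j)%N].
have Lk : (#|L| <= k)%N.
  rewrite leqNgt; apply/negP => kL.
  have [|i] := mst (fun i => @enum_val _ L (widen_ord kL i)).
    by move=> i i' /enum_val_inj/(congr1 val)/= /val_inj.
  by have := @enum_valP _ L (widen_ord kL i); rewrite inE leqNgt => /negP.
pose h : {ffun 'I_k -> 'I_s.+1} :=
  [ffun i : 'I_k => inord (nth 0%N [seq m j | j <- enum L] i)].
have mj j : (m j < s.+1)%N.
  by rewrite ltnS; apply: leq_trans ms; rewrite mdegE (bigD1 j) //= leq_addr.
have /choice[c cE] : forall j, exists z : 'I_k + 'I_D,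
    match z with inl i => h i : nat | inr d => d end = m j.
  move=> j; have [mD|Dm] := ltnP (m j) D; first by exists (inr (Ordinal mD)).
  have jL : j \in enum L by rewrite mem_enum inE.
  have ji : (index j (enum L) < k)%N.
    by apply: leq_trans Lk; rewrite cardE index_mem.
  exists (inl (Ordinal ji)); rewrite ffunE /=.
  by rewrite (nth_map j) ?index_mem // nth_index // inordK.
by exists (finfun c, h) => j; rewrite /std_exp /= ffunE cE.
Qed.

Lemma std_span s (p : mpoly n K) : mdeg_le s p ->
  (forall m, m \in msupp p -> standard k.+1 D m) ->
  spanned (@std_fun s) (fun t => meval (x t) p).
Proof.
move=> ps pst.
pose mon (m : multinom n) t := \prod_j x t j ^+ m j.
apply: (@spanned_sum _ _ _ _ _ (msupp p)
  (fun m => mcoeff m p) (fun m => if m \in msupp p then mon m else fun=> 0)).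
  move=> m; case: ifP => [mp|_]; last first.
    by exists (fun=> 0) => t; rewrite big1 // => *; rewrite mul0r.
  have [w wE] := std_code_exists (pst m mp) (ps m mp).
  apply: (@spanned_gen _ _ _ _ w) => t.
  by apply: eq_bigr => j _; rewrite wE.
move=> t; rewrite mevalE big_seq [RHS]big_seq.
by apply: eq_bigr => m mp; rewrite mp.
Qed.

End Count.

(** * Algebraic dependence of algebraic functions *)

Section Dependence.
Variables (K : fieldType) (n : nat) (T : Type) (x : T -> 'I_n -> K).

(** With a the leading coefficient of G, the equation reads
    a f^d = - (lower terms); each power of a spent lowers the exponent of f by
    one, and adds at most B to the degree of the coefficients. *)
Lemma power_reduction (f : T -> K) (G : {poly mpoly n K}) d B :
  size G = d.+1 -> (forall i, mdeg_le B G`_i) ->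
  (forall t, (map_poly (meval (x t)) G).[f t] = 0) ->
  forall e s, (e <= s)%N -> exists2 h : nat -> mpoly n K,
    forall i, mdeg_le (s * B) (h i)
  & forall t, meval (x t) (lead_coef G) ^+ s * f t ^+ e =
              \sum_(i < d.+1) meval (x t) (h i) * f t ^+ i.
Proof.
move=> sG GB Gf e s; set a := lead_coef G.
have aB : mdeg_le B a by exact: GB.
elim: s e => [|s IHs] e; last case: e => [_|e].
- rewrite leqn0 => /eqP ->; exists (fun i => (i == 0)%:R) => [i m|t].
    case: (i == 0); last by rewrite msupp0.
    by rewrite msupp1 inE => /eqP ->; rewrite mdeg0.
  rewrite big_ord_recl /= meval1 big1 ?addr0 // => i _.
  by rewrite raddf0 mul0r.
- exists (fun i => if i is 0%N then a ^+ s.+1 else 0) => [[|i]|t].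
  + exact: mdeg_leX.
  + exact: mdeg_le0.
  + rewrite big_ord_recl /= rmorphXn big1 ?addr0 // => i _.
    by rewrite raddf0 mul0r.
rewrite ltnS => /IHs[h hB hE].
exists (fun i => if i is i'.+1 then a * h i' - h d * G`_i' else 0) => [[|i]|t].
- exact: mdeg_le0.
- rewrite mulSn; apply: mdeg_leD; first exact: mdeg_leM.
  by apply: mdeg_leN; rewrite addnC; apply: mdeg_leM.
rewrite exprS [f t ^+ _]exprS mulrACA hE.
have := Gf t; rewrite (@horner_coef_wide _ d.+1); last first.
  by rewrite -sG; exact: size_poly.
rewrite big_ord_recr /= coef_map /=.
have -> : G`_d = a by rewrite /a lead_coefE sG.
move=> /eqP; rewrite addrC addr_eq0 => /eqP aE.
rewrite [RHS]big_ord_recl /= raddf0 mul0r add0r big_ord_recr /= mulrDr.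
have -> : meval (x t) a * f t * (meval (x t) (h d) * f t ^+ d) =
    f t * meval (x t) (h d) * (meval (x t) a * f t ^+ d) by ring.
rewrite aE mulrN; set u := f t * meval (x t) (h d).
rewrite [X in X - _]mulr_sumr [X in _ - X]mulr_sumr -sumrB.
by apply: eq_bigr => i _; rewrite mevalB !mevalM coef_map /= exprS /u; ring.
Qed.

Section SameDegree.
Variables (k d : nat) (f : T -> 'I_k.+1 -> K).
Variable G : 'I_k.+1 -> {poly mpoly n K}.
Hypothesis sG : forall j, size (G j) = d.+1.
Hypothesis Ga : forall j t, meval (x t) (lead_coef (G j)) != 0.
Hypothesis Gf : forall j t, (map_poly (meval (x t)) (G j)).[f t j] = 0.
Hypothesis rel : forall g : 'I_k.+1 -> 'I_n, injective g ->
  exists2 F : mpoly k.+1 K, F != 0 & forall t, meval (x t \o g) F = 0.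

Lemma leq_expn a b m : (a <= b -> a ^ m <= b ^ m)%N.
Proof. by move=> ab; case: m => // m; rewrite leq_exp2r. Qed.

Definition box_mon s (e : {ffun 'I_k.+1 -> 'I_s.+1}) : multinom k.+1 :=
  Multinom (mktuple (fun j => e j : nat)).

Lemma box_monE s (e : {ffun 'I_k.+1 -> 'I_s.+1}) j : box_mon e j = e j.
Proof. exact: mnmE. Qed.

Lemma box_mon_inj s : injective (@box_mon s).
Proof.
move=> e e' ee; apply/ffunP => j; apply: val_inj => /=.
by rewrite -!box_monE ee.
Qed.

(** After multiplication by a power of the leading coefficients, the (s+1)^k.+1
    monomials in f with exponents at most s all lie in the span of the products
    of a standard monomial in x and a monomial in f with exponents at most d,
    whose number is O(s^k). *)
Lemma dependent_same_degree :
  exists2 Q : mpoly k.+1 K, Q != 0 & forall t, meval (f t) Q = 0.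
Proof.
have [D stD] := standard_form rel.
pose B := (\max_j \max_(i < d.+1) msize (G j)`_i)%N.
have GB j i : mdeg_le B (G j)`_i.
  have [id|di] := ltnP i d.+1; last by rewrite nth_default ?sG //; exact: mdeg_le0.
  apply: mdeg_leW (@mdeg_le_msize _ _ _).
  apply: leq_trans (leq_bigmax j); exact: (leq_bigmax (Ordinal id)).
pose C := ((k + D) ^ n * (k.+1 * B).+1 ^ k * d.+1 ^ k.+1)%N.
(* C bounds the number of codes divided by s.+1 ^ k; any s >= C would do. *)
pose s := C; pose S := (k.+1 * (s * B))%N.
pose W : finType := (std_code k n D S * {ffun 'I_k.+1 -> 'I_d.+1})%type.
pose b (w : W) t := std_fun x w.1 t * \prod_j f t j ^+ w.2 j.
pose v (e : {ffun 'I_k.+1 -> 'I_s.+1}) t :=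
  (\prod_j meval (x t) (lead_coef (G j)) ^+ s) * \prod_j f t j ^+ e j.
have WE : (#|W| < #|{: {ffun 'I_k.+1 -> 'I_s.+1}}|)%N.
  rewrite card_prod card_std_code !card_ffun !card_ord [X in (_ < X)%N]expnS.
  have Sle : (S.+1 <= (k.+1 * B).+1 * s.+1)%N.
    by rewrite /S mulnCA mulSn -addn1 addnC mulnS mulnC; lia.
  have : (S.+1 ^ k <= (k.+1 * B).+1 ^ k * s.+1 ^ k)%N.
    by rewrite -expnMn; exact: leq_expn.
  have : (0 < s.+1 ^ k)%N by rewrite expn_gt0.
  move: (S.+1 ^ k)%N (s.+1 ^ k)%N => X Y Y0 XY.
  apply: (@leq_ltn_trans (C * Y)); last by rewrite ltn_pmul2r.
  rewrite /C [leqRHS]mulnAC leq_mul2r; apply/orP; right.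
  by rewrite -mulnA leq_mul2l XY orbT.
have vb e : spanned b (v e).
  have /choice[h hP] j : exists h : nat -> mpoly n K,
      (forall i, mdeg_le (s * B) (h i)) /\
      forall t, meval (x t) (lead_coef (G j)) ^+ s * f t j ^+ e j =
                \sum_(i < d.+1) meval (x t) (h i) * f t j ^+ i.
    have es : (e j <= s)%N by rewrite -ltnS.
    by have [h] := power_reduction (sG j) (GB j) (Gf j) es; exists h.
  have /choice[c cE] (l : {ffun 'I_k.+1 -> 'I_d.+1}) :
      spanned (@std_fun _ k n D _ x S) (fun t => meval (x t) (\prod_j h j (l j))).
    have [q [qx qS qst]] := stD (\prod_j h j (l j)).
    have qSS : mdeg_le S q.
      apply: qS; rewrite -big_enum /S -[X in (X * _)%N](size_enum_ord k.+1).
      by apply: mdeg_le_prod => j; have [] := hP j.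
    have [c cE] := @std_span _ _ _ _ _ x _ _ qSS qst.
    by exists c => t; rewrite -qx cE.
  exists (fun w => c w.2 w.1) => t; rewrite /v -big_split /=.
  under eq_bigr do rewrite (hP _).2.
  rewrite bigA_distr_bigA -(pair_bigA _ (fun w l => c l w * b (w, l) t)).
  rewrite exchange_big /=.
  apply: eq_bigr => l _; rewrite big_split /=.
  rewrite -(rmorph_prod (meval (x t))) /=.
  rewrite (cE l t) mulr_suml.
  by apply: eq_bigr => w _; rewrite mulrA.
have [c [e0 ce0] cv] := spanned_dependent WE vb.
exists (\sum_e c e *: mpolyX K (box_mon e)).
  apply/eqP => /(congr1 (mcoeff (box_mon e0))).
  rewrite raddf_sum (bigD1 e0) //= mcoeffZ mcoeffX eqxx mulr1 big1 => [|e ee0].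
    by rewrite addr0 raddf0 => /eqP; rewrite (negPf ce0).
  by rewrite mcoeffZ mcoeffX (inj_eq (@box_mon_inj s)) (negPf ee0) mulr0.
move=> t; have a0 : \prod_j meval (x t) (lead_coef (G j)) ^+ s != 0.
  by apply/prodf_neq0 => j _; rewrite expf_neq0.
apply: (mulfI a0); rewrite mulr0 -[RHS](cv t) raddf_sum mulr_sumr.
apply: eq_bigr => e _; rewrite /= mevalZ mevalX /v mulrCA; congr (_ * (_ * _)).
by apply: eq_bigr => j _; rewrite box_monE.
Qed.

End SameDegree.
End Dependence.

(** The polynomial may change with the point, and its degree in the last
    variable may drop after specialization at the point. *)
Definition piecewise_algebraic (K : fieldType) n T (x : T -> 'I_n -> K)
    (f : T -> K) : Prop :=
  exists L : seq {poly mpoly n K}, forall t, exists2 G, G \in L &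
    map_poly (meval (x t)) G != 0 /\ root (map_poly (meval (x t)) G) (f t).

Lemma dependent_algebraic (K : fieldType) n T (x : T -> 'I_n -> K)
    k (f : T -> 'I_k.+1 -> K) (G : 'I_k.+1 -> {poly mpoly n K}) :
  (forall j t, meval (x t) (lead_coef (G j)) != 0) ->
  (forall j t, root (map_poly (meval (x t)) (G j)) (f t j)) ->
  (forall g : 'I_k.+1 -> 'I_n, injective g ->
    exists2 F : mpoly k.+1 K, F != 0 & forall t, meval (x t \o g) F = 0) ->
  exists2 Q : mpoly k.+1 K, Q != 0 & forall t, meval (f t) Q = 0.
Proof.
move=> Ga Gf rel; have [[t0 _]|T0] := pselect (exists t : T, True); last first.
  by exists 1 => [|t]; [exact: oner_neq0|case: T0; exists t].
have G0 j : G j != 0.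
  by apply: contraNneq (Ga j t0) => ->; rewrite lead_coef0 meval0.
pose d := (\max_j size (G j))%N.
have Gd j : (size (G j) <= d)%N by exact: leq_bigmax.
apply: (@dependent_same_degree _ _ _ _ _ d f
  (fun j => G j * 'X^(d.+1 - size (G j)))) => //.
- move=> j; rewrite size_Mmonic ?monicXn // size_polyXn addnS /= subnKC //.
  exact: leqW (Gd j).
- by move=> j t; rewrite lead_coef_Mmonic ?monicXn.
- by move=> j t; rewrite rmorphM hornerM (rootP (Gf j t)) mul0r.
- exact: rel.
Qed.

(** Truncation of the polynomials at all degrees puts the leading coefficient of
    the specialized polynomial at the top. *)
Lemma piecewise_lead (K : fieldType) n T (x : T -> 'I_n -> K) (f : T -> K) :
  piecewise_algebraic x f ->
  exists L : seq {poly mpoly n K}, forall t, exists2 G, G \in L &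
    meval (x t) (lead_coef G) != 0 /\ root (map_poly (meval (x t)) G) (f t).
Proof.
move=> [L LP]; exists [seq take_poly i G | G <- L, i <- iota 0 (size G).+1] => t.
have [G GL [G0 Gf]] := LP t.
pose H := map_poly (meval (x t)) G.
have HE : map_poly (meval (x t)) (take_poly (size H) G) = H.
  apply/polyP => i; rewrite coef_map coef_take_poly /=.
  case: ltnP => [|Hi]; first by rewrite coef_map.
  by rewrite raddf0 nth_default.
exists (take_poly (size H) G).
  apply: allpairs_f_dep => //; rewrite mem_iota add0n ltnS /=.
  exact: size_poly.
rewrite HE; split=> //; rewrite lead_coefE.
have := G0; rewrite -lead_coef_eq0 -/H lead_coefE -{1}HE coef_map /=.
suff -> : size (take_poly (size H) G) = size H by [].
apply/eqP; rewrite eqn_leq size_take_poly /= -{1}HE; exact: size_poly.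
Qed.

(** On each of the finitely many pieces where the choice of polynomials is
    constant, the functions satisfy a relation; the product of these relations
    holds everywhere. *)
Theorem piecewise_dependent (K : fieldType) n T (x : T -> 'I_n -> K)
    k (f : T -> 'I_k -> K) :
  (forall j, piecewise_algebraic x (f^~ j)) ->
  (forall g : 'I_k -> 'I_n, injective g ->
    exists2 F : mpoly k K, F != 0 & forall t, meval (x t \o g) F = 0) ->
  exists2 Q : mpoly k K, Q != 0 & forall t, meval (f t) Q = 0.
Proof.
case: k f => [|k] f fx rel.
  (* A relation between no coordinates is a nonzero constant that vanishes at
     every point. *)
  have [|F F0 Fx] := rel (fun i => match notF (valP i) with end).
    by case.
  exists F => // t; rewrite -[RHS](Fx t); apply: meval_eq; by case.
have /choice[L LP] j := piecewise_lead (fx j).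
pose s := flatten (codom L).
have sP t j : exists2 i : 'I_(size s), meval (x t) (lead_coef s`_i) != 0
    & root (map_poly (meval (x t)) s`_i) (f t j).
  have [G GL [G0 Gf]] := LP j t.
  have Gs : G \in s by apply/flattenP; exists (L j) => //; exact: codom_f.
  have Gi : (index G s < size s)%N by rewrite index_mem.
  by exists (Ordinal Gi); rewrite /= nth_index.
pose piece (a : {ffun 'I_k.+1 -> 'I_(size s)}) t := forall j,
  meval (x t) (lead_coef s`_(a j)) != 0 /\
  root (map_poly (meval (x t)) s`_(a j)) (f t j).
have /choice[Q QP] a : exists Q : mpoly k.+1 K,
    Q != 0 /\ forall t, piece a t -> meval (f t) Q = 0.
  have [||g /rel[F F0 Fx]|Q Q0 Qf] := @dependent_algebraic K n {t | piece a t}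
    (fun t => x (sval t)) k (fun t => f (sval t)) (fun j => s`_(a j)).
  - by move=> j [t /= /(_ j)[]].
  - by move=> j [t /= /(_ j)[]].
  - by exists F.
  - by exists Q; split=> // t at'; have := Qf (exist _ t at').
exists (\prod_a Q a); first by apply/prodf_neq0 => a _; have [] := QP a.
move=> t; have /choice[a aP] : forall j, exists i : 'I_(size s),
    meval (x t) (lead_coef s`_i) != 0 /\ root (map_poly (meval (x t)) s`_i) (f t j).
  by move=> j; have [i ? ?] := sP t j; exists i.
rewrite rmorph_prod (bigD1 (finfun a)) //= (QP (finfun a)).2 ?mul0r // => j.
by rewrite ffunE.
Qed.

(** * Semialgebraic functions are piecewise algebraic *)

Section SemialgebraicFunctions.
Variables (R : rcfType) (n : nat).

Definition last_univariate : mpoly (n + 1) R -> {poly mpoly n R} :=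
  univariate (fun i => if fintype.split i is inl j then Some j else None).

Lemma last_univariateE (p : mpoly (n + 1) R) (x : 'rV[R]_n) t :
  (map_poly (meval (x 0)) (last_univariate p)).[t] =
  meval ((row_mx x t%:M) 0) p.
Proof.
rewrite horner_univariate; apply: meval_eq => i; rewrite mxE.
by case: (fintype.split i) => // j; rewrite ord1 mxE eqxx mulr1n.
Qed.

(** Along a vertical line the sign of a polynomial is locally constant, except
    where the polynomial vanishes without vanishing on the whole line. *)
Lemma semialgebraic_boundary (A : set 'rV[R]_(n + 1)) : semialgebraic A ->
  exists L : seq {poly mpoly n R}, forall (x : 'rV[R]_n) t,
    (forall G, G \in L -> let Gx := map_poly (meval (x 0)) G in
       Gx = 0 \/ Gx.[t] != 0) ->
    exists2 e : R, 0 < e & forall u, `|u - t| < e ->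
      A (row_mx x t%:M) <-> A (row_mx x u%:M).
Proof.
have sgn_near (p : mpoly (n + 1) R) (x : 'rV[R]_n) t :
    let Gx := map_poly (meval (x 0)) (last_univariate p) in
    Gx = 0 \/ Gx.[t] != 0 ->
    exists2 e : R, 0 < e & forall u, `|u - t| < e ->
      Num.sg (meval ((row_mx x t%:M) 0) p) = Num.sg (meval ((row_mx x u%:M) 0) p).
  move=> Gx [Gx0|Gxt].
    by exists 1 => // u _; rewrite -!last_univariateE -/Gx Gx0 !horner0.
  have [|e e0 eP] := @poly_cont _ t Gx `|Gx.[t]|; first by rewrite normr_gt0.
  exists e => // u /eP; rewrite -!last_univariateE -/Gx.
  rewrite ltr_norml; case: (ltrgtP Gx.[t] 0) Gxt => // Gxt _ /andP[h1 h2].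
    by rewrite !ltr0_sg //; move: h2; rewrite ltr0_norm //; lra.
  by rewrite !gtr0_sg //; move: h1; rewrite gtr0_norm //; lra.
elim=> {A} [p|p|A _ [L LP]|A B _ [L LP] _ [L' LP']|A B _ [L LP] _ [L' LP']].
- exists [:: last_univariate p] => x t /(_ _ (mem_head _ _))/sgn_near[e e0 eP].
  exists e => // u /eP /= sgE.
  split=> /eqP + ; rewrite -sgr_eq0 => h; apply/eqP; rewrite -sgr_eq0.
    by rewrite -sgE.
  by rewrite sgE.
- exists [:: last_univariate p] => x t /(_ _ (mem_head _ _))/sgn_near[e e0 eP].
  by exists e => // u /eP /= sgE; rewrite -sgr_gt0 sgE sgr_gt0.
- exists L => x t /LP[e e0 eP]; exists e => // u /eP AE.
  by split=> /= nA /AE.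
- exists (L ++ L') => x t Lt.
  have [G GL|e e0 eP] := LP x t; first by apply: Lt; rewrite mem_cat GL.
  have [G GL|e' e'0 eP'] := LP' x t; first by apply: Lt; rewrite mem_cat GL orbT.
  exists (Num.min e e'); first by rewrite lt_min e0.
  move=> u; rewrite lt_min => /andP[/eP AE /eP' BE].
  by split=> -[/AE ? /BE ?].
- exists (L ++ L') => x t Lt.
  have [G GL|e e0 eP] := LP x t; first by apply: Lt; rewrite mem_cat GL.
  have [G GL|e' e'0 eP'] := LP' x t; first by apply: Lt; rewrite mem_cat GL orbT.
  exists (Num.min e e'); first by rewrite lt_min e0.
  move=> u; rewrite lt_min => /andP[/eP AE /eP' BE].
  by split=> -[/AE|/BE]; [left|right|left|right].
Qed.

(** The fiber of the graph over x is one point, which is not open in the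
    vertical line; so some polynomial of the graph vanishes there without
    vanishing on the whole line. *)
Lemma semialg_piecewise_algebraic (M : set 'rV[R]_n) (f : M -> R) :
  semialgebraic (graph f) ->
  piecewise_algebraic (fun x : M => val x 0) f.
Proof.
move=> /semialgebraic_boundary[L LP]; exists L => x.
apply: contrapT => /forall2NP noG.
have [G GL|e e0 eP] := LP (val x) (f x).
  have [//|/not_andP[G0|Gf]] := noG G.
    by left; apply: contrapT => /eqP.
  by right; apply/negP.
have [/= y _ yx] : graph f (row_mx (val x) (f x + e / 2)%:M).
  apply/eP; last by exists x.
  by rewrite addrC addKr gtr0_norm ?divr_gt0 // ltr_pdivrMr // ltr_pMr // ltr1n.
have [/val_inj xy /matrixP/(_ 0 0)] := eq_row_mx yx.
rewrite !mxE !mulr1n xy => /eqP; rewrite -subr_eq0 opprD addrA subrr add0r.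
by rewrite oppr_eq0 gt_eqF // divr_gt0.
Qed.

End SemialgebraicFunctions.

(** * Chains of prime ideals *)

Local Open Scope classical_set_scope.

Section PrimeIdeals.
Variable A : comPzRingType.
Implicit Types (P : prime_ideal A) (a b : A).

Lemma prime_ideal_sum P I (r : seq I) (Q : pred I) (F : I -> A) :
  (forall i, Q i -> prime_carrier P (F i)) ->
  prime_carrier P (\sum_(i <- r | Q i) F i).
Proof.
move=> PF; elim/big_ind: _ => //; [exact: prime_ideal0|exact: prime_idealD].
Qed.

Lemma prime_idealN P a : prime_carrier P a -> prime_carrier P (- a).
Proof. by rewrite -mulN1r; apply: prime_idealMl. Qed.

Lemma prime_idealMr P a b : prime_carrier P a -> prime_carrier P (a * b).
Proof. by rewrite mulrC; apply: prime_idealMl. Qed.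

Lemma prime_ideal_cancelX P a e b : ~ prime_carrier P a ->
  prime_carrier P (a ^+ e * b) -> prime_carrier P b.
Proof.
move=> Pa; elim: e => [|e IHe]; first by rewrite expr0 mul1r.
by rewrite exprS -mulrA => /prime_idealM[].
Qed.

Lemma residue_eq0 P a : residue_map P a = 0 <-> prime_carrier P a.
Proof.
have -> : (residue_map P a = 0) = (residue_map P a == 0).
  by apply/propext; split=> /eqP.
rewrite /= tofrac_eq0 -(rmorph0 (@prime_proj A P)) /prime_proj.
rewrite -Quotient.idealrBE subr0; split; first by move=> /asboolP.
by move=> Pa; apply/asboolP.
Qed.

(** An ideal maximal among those that avoid a multiplicative set is prime. *)
Lemma prime_avoiding (I T : set A) :
  I 0 -> (forall a b, I a -> I b -> I (a + b)) -> (forall a b, I b -> I (a * b)) ->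
  T 1 -> (forall a b, T a -> T b -> T (a * b)) ->
  (forall a, I a -> ~ T a) ->
  exists P : prime_ideal A, I `<=` P /\ forall a, prime_carrier P a -> ~ T a.
Proof.
move=> I0 ID IM T1 TM IT.
pose good (X : set A) := [/\ I `<=` X, (forall a b, X a -> X b -> X (a + b)),
  (forall a b, X b -> X (a * b)) & forall a, X a -> ~ T a].
have good0 : good I by split.
(* The empty set is admitted because it is the union of the empty chain. *)
have [F Fgood Ftot|X [[X0|Xgood] Xmax]] :=
  @Zorn_bigcup A (fun X => X = set0 \/ good X).
- have [[X [FX [a Xa]]]|F0] := pselect (exists X, F X /\ X !=set0); last first.
    left; apply/seteqP; split=> // a [X FX Xa].
    by apply: F0; exists X; split=> //; exists a.
  have good_of Y b : F Y -> Y b -> good Y.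
    by move=> /Fgood[-> //|].
  right; split=> [b Ib|b c [Y FY Yb] [Z FZ Zc]|b c [Y FY Yc]|b [Y FY Yb]].
  + by exists X => //; have [+ _ _ _] := good_of _ _ FX Xa; apply.
  + have [YZ|ZY] := Ftot _ _ FY FZ.
      by exists Z => //; have [_ + _ _] := good_of _ _ FZ Zc; apply => //; exact: YZ.
    by exists Y => //; have [_ + _ _] := good_of _ _ FY Yb; apply => //; exact: ZY.
  + by exists Y => //; have [_ _ + _] := good_of _ _ FY Yc; apply.
  + by have [_ _ _ +] := good_of _ _ FY Yb; apply.
- exfalso; apply: (Xmax I); last by right.
  by rewrite X0; split=> // /(_ 0 I0).
have [IX XD XM XT] := Xgood.
have meets a : ~ X a -> exists2 t, T t & exists w r, X w /\ t = w + r * a.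
  move=> Xa; apply: contrapT => /forall2NP noT.
  apply: (Xmax [set t | exists w r, X w /\ t = w + r * a]).
    split=> [b Xb|/(_ a)].
      by exists b, 0; rewrite mul0r addr0.
    move=> /(_ _)/Xa; apply; exists 0, 1.
    by rewrite mul1r add0r; split => //; exact: IX.
  right; split=> [b /IX Xb|b c [w [r [Xw ->]]] [w' [r' [Xw' ->]]]|b c [w [r [Xw ->]]]|b].
  + by exists b, 0; rewrite mul0r addr0.
  + exists (w + w'), (r + r'); split; first exact: XD.
    by rewrite mulrDl addrACA.
  + by exists (b * w), (b * r); rewrite mulrDr mulrA; split=> //; exact: XM.
  + by move=> wr Tb; case: (noT b).
have P1 : ~ X 1 by move=> /XT; apply.
have PM a b : X (a * b) -> X a \/ X b.
  move=> Xab; apply: contrapT => /not_orP[/meets[t Tt [w [r [Xw tE]]]]].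
  move=> /meets[t' Tt' [w' [r' [Xw' tE']]]].
  apply: (XT (t * t')); last exact: TM.
  rewrite tE tE' mulrDl; apply: (XD); first by rewrite mulrC; exact: XM.
  rewrite mulrDr; apply: (XD); first exact: XM.
  by rewrite mulrACA; exact: XM.
by exists (PrimeIdeal (IX _ I0) XD XM P1 PM).
Qed.

(** A nontrivial algebraic relation between elements a_i of P_i.+1 outside P_i
    would, by its lexicographically lowest term, put a constant in a prime. *)
Lemma chain_independent (K : fieldType) (cst : {rmorphism K -> A}) k
    (P : 'I_k.+1 -> prime_ideal A) :
  (forall i j : 'I_k.+1, (i < j)%N -> P i `<` P j) ->
  exists a : 'I_k -> A, forall Q : mpoly k K,
    \sum_(m <- msupp Q) cst (mcoeff m Q) * \prod_i a i ^+ m i = 0 -> Q = 0.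
Proof.
move=> Plt.
have /choice[a aP] (i : 'I_k) : exists a, 
      prime_carrier (P (lift ord0 i)) a /\
      ~ prime_carrier (P (widen_ord (leqnSn k) i)) a.
  have [_] := Plt (widen_ord (leqnSn k) i) (lift ord0 i) (ltnSn i).
  by move=> /existsNP[b /not_implyP[Pb nPb]]; exists b.
exists a => Q Qa; apply: contrapT => /eqP Q0.
(* Keep, coordinate by coordinate, the terms with the lowest exponent of a_i:
   the power of a_i that divides them is not in P_i, and the other terms are
   in P_i.+1 after division. *)
pose partial i (s : seq (multinom k)) :=
  \sum_(m <- s) cst (mcoeff m Q) * \prod_(j < k | (i <= j)%N) a j ^+ m j.
suff /(_ k (leqnn k))[s [sQ s0 us sE sP]] : forall i, (i <= k)%N ->
    exists s : seq (multinom k),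
    [/\ {subset s <= msupp Q}, s != [::], uniq s,
        {in s &, forall m m' : multinom k, forall j : 'I_k, (j < i)%N -> m j = m' j}
      & prime_carrier (P (inord i)) (partial i s)].
  case: s s0 sQ us sE sP => [//|m [|m' s]] _ sQ us sE sP; last first.
    have mm' : m = m'.
      apply/mnmP => j; apply: (sE m m') => //; first exact: mem_head.
      by rewrite !inE eqxx orbT.
    by rewrite mm' /= mem_head in us.
  have : prime_carrier (P (inord k)) (cst (mcoeff m Q)^-1 * partial k [:: m]).
    exact: prime_idealMl.
  rewrite /partial big_seq1 big1 => [|j]; last by rewrite leqNgt ltn_ord.
  rewrite mulr1 -rmorphM mulVf ?rmorph1; first exact: prime_ideal1.
  by rewrite -mcoeff_msupp sQ // mem_head.
elim=> [|i IHi] ik.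
  exists (msupp Q); split=> [//|||//|]; [by rewrite msupp_eq0|exact: msupp_uniq|].
  by rewrite /partial Qa; exact: prime_ideal0.
have [s [sQ s0 us sE sP]] := IHi (ltnW ik).
pose i' : 'I_k := Ordinal ik.
have [m0 m0s m0P] : exists2 m0, m0 \in s & forall m, m \in s -> (m0 i' <= m i')%N.
  case: s s0 {sQ us sE sP} => // m s _; elim: s m => [|m' s IHs] m.
    by exists m; rewrite ?mem_head // => m'; rewrite inE => /eqP ->.
  have [m0 m0s m0P] := IHs m.
  have [le0|lt0] := leqP (m0 i') (m' i').
    exists m0; first by move: m0s; rewrite !inE => /orP[->//|->]; rewrite !orbT.
    move=> m1; rewrite !inE => /or3P[/eqP ->|/eqP -> //|m1s]; apply: m0P.
      exact: mem_head.
    by rewrite inE m1s orbT.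
  exists m'; first by rewrite !inE eqxx orbT.
  move=> m1; rewrite !inE => /or3P[/eqP ->|/eqP -> //|m1s].
    apply: leq_trans (ltnW lt0) (m0P _ _); exact: mem_head.
  by apply: leq_trans (ltnW lt0) (m0P _ _); rewrite inE m1s orbT.
pose r := [seq m : multinom k <- s | m i' == m0 i'].
exists r; split.
- by move=> m; rewrite mem_filter => /andP[_ /sQ].
- by apply/eqP => /(congr1 (fun s => m0 \in s)); rewrite mem_filter eqxx m0s.
- exact: filter_uniq.
- move=> m m'; rewrite !mem_filter => /andP[/eqP mi ms] /andP[/eqP mi' ms'] j.
  rewrite ltnS leq_eqVlt => /orP[/eqP ji|]; last exact: sE.
  by have -> : j = i'; [exact: val_inj|rewrite mi].
have [ai' nai'] := aP i'.
have Pi : P (inord i) = P (widen_ord (leqnSn k) i').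
  by congr (P _); apply: val_inj; rewrite /= inordK // ltnS ltnW.
have Pi1 : P (inord i.+1) = P (lift ord0 i').
  by congr (P _); apply: val_inj; rewrite /= inordK.
pose tail (m : multinom k) := \prod_(j < k | (i.+1 <= j)%N) a j ^+ m j.
have tailE (m : multinom k) :
    \prod_(j < k | (i <= j)%N) a j ^+ m j = a i' ^+ m i' * tail m.
  rewrite (bigD1 i') //=; congr (_ * _); apply: eq_bigl => j.
  by rewrite ltn_neqAle andbC eq_sym.
have sum_in : prime_carrier (P (inord i))
    (\sum_(m <- s) cst (mcoeff m Q) * (a i' ^+ (m i' - m0 i') * tail m)).
  rewrite Pi; apply: (@prime_ideal_cancelX _ _ (m0 i') _ nai'); rewrite -Pi.
  rewrite mulr_sumr big_seq (_ : \sum_(_ <- _ | _) _ = partial i s) // /partial.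
  rewrite [RHS]big_seq; apply: eq_bigr => m /m0P le_m0.
  by rewrite tailE mulrCA [a i' ^+ _ * (_ * _)]mulrA -exprD subnKC.
have : prime_carrier (P (inord i.+1))
    (\sum_(m <- s) cst (mcoeff m Q) * (a i' ^+ (m i' - m0 i') * tail m)).
  have [|+ _] := Plt (inord i) (inord i.+1); last by apply.
  by rewrite !inordK // ltnS ltnW.
rewrite (bigID (fun m : multinom k => m i' == m0 i')) /= -big_filter -/r => Psum.
rewrite /partial -[X in prime_carrier _ X](addrK
  (\sum_(m <- s | (m : multinom k) i' != m0 i')
    cst (mcoeff m Q) * (a i' ^+ (m i' - m0 i') * tail m))).
apply: prime_idealD.
  rewrite [X in prime_carrier _ (X + _)](_ : _ = \sum_(m <- r)
    cst (mcoeff m Q) * (a i' ^+ (m i' - m0 i') * tail m)) //.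
  apply: eq_big_seq => m; rewrite mem_filter => /andP[/eqP -> _].
  by rewrite subnn expr0 mul1r.
apply: prime_idealN; rewrite big_seq_cond; apply: prime_ideal_sum => m.
move=> /andP[/m0P le_m0 ne_m0]; apply: prime_idealMl; apply: prime_idealMr.
have : (0 < m i' - m0 i')%N by rewrite subn_gt0 ltn_neqAle eq_sym ne_m0.
case: (m i' - m0 i')%N => // e _; rewrite exprS Pi1; exact: prime_idealMr.
Qed.

End PrimeIdeals.

(** * Going up *)

Section GoingUp.
Variables (R : numFieldType) (m n : nat) (A : comPzRingType).
Variables (phi : {rmorphism mpoly m R -> A}) (x : 'I_n -> A).
Hypothesis phi_inj : forall F, phi F = 0 -> F = 0.
Hypothesis x_algebraic : forall j, exists2 G : {poly mpoly m R},
  G != 0 & \sum_(l < size G) phi G`_l * x j ^+ l = 0.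
Hypothesis x_generate : forall b, exists p : mpoly n R,
  b = \sum_(e <- msupp p) phi (mpolyC m (mcoeff e p)) * \prod_j x j ^+ e j.

Lemma prime_above0 : exists P : prime_ideal A,
  forall F, prime_carrier P (phi F) -> F = 0.
Proof.
have [|||||_ -> [F /eqP F0 F0E]|P [_ PT]] := @prime_avoiding A [set 0]
  [set phi F | F in [set F | F != 0]].
- by [].
- by move=> a b -> ->; rewrite addr0.
- by move=> a b ->; rewrite mulr0.
- by exists 1; rewrite ?rmorph1 //=; exact: oner_neq0.
- move=> _ _ [F F0 <-] [G G0 <-]; exists (F * G); last by rewrite rmorphM.
  exact: mulf_neq0.
- by apply: F0; exact: phi_inj.
exists P => F PF; apply: contrapT => /eqP F0; apply: (PT _ PF); by exists F.
Qed.

(** After inversion of s, the product of the leading coefficients of the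
    equations of the generators, these generators are integral modulo P0, hence
    every element of A is.  The integral equation is stated with its
    denominators cleared, which leaves a power of s as leading coefficient. *)
Lemma integral_after_localization (P0 : prime_ideal A) :
  (forall F, prime_carrier P0 (phi F) -> F = 0) ->
  exists2 s, s != 0 & forall b, exists N d (h : nat -> mpoly m R),
    h d = s ^+ N /\ prime_carrier P0 (\sum_(l < d.+1) phi (h l) * b ^+ l).
Proof.
move=> P0phi.
have [K [rho rho0]] : exists (K : fieldType) (rho : {rmorphism A -> K}),
    forall a, rho a = 0 <-> prime_carrier P0 a.
  by exists (residue_field P0), (residue_map P0) => a; exact: residue_eq0.
have /choice[G GP] (j : 'I_n) : exists G : {poly mpoly m R},
    G != 0 /\ \sum_(l < size G) phi G`_l * x j ^+ l = 0.
  by have [G] := x_algebraic j; exists G.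
pose s := \prod_j lead_coef (G j).
have s0 : s != 0.
  by apply/prodf_neq0 => j _; rewrite lead_coef_eq0; have [] := GP j.
exists s => // b.
have [psi psiE] : exists psi : {rmorphism mpoly m R -> K},
    forall F, psi F = rho (phi F) by exists (rho \o phi).
have psi0 F : psi F = 0 -> F = 0 by rewrite psiE => /rho0/P0phi.
have psis : psi s != 0 by apply: contra_neq s0 => /psi0.
pose u := (psi s)^-1.
(* The localization at s is the image of a polynomial ring in one more variable,
   which is mapped to the inverse of s. *)
have [iota iotaE] : exists iota : {rmorphism {poly mpoly m R} -> K},
    forall q, iota q = (map_poly psi q).[u].
  have cfu : commr_rmorph psi u by move=> F; exact: mulrC.
  by exists (horner_morph cfu).
have iotaC F : iota F%:P = psi F by rewrite iotaE map_polyC hornerC.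
have iotaX : iota 'X = u by rewrite iotaE map_polyX hornerX.
have x_int j : integralOver iota (rho (x j)).
  have [G0 Gx] := GP j; set c := psi (lead_coef (G j)).
  have c0 : c != 0.
    by rewrite /c; apply: contra_neq G0 => /psi0/eqP; rewrite lead_coef_eq0 => /eqP.
  pose p := c^-1 *: map_poly psi (G j).
  apply: (@integral_root_monic _ _ _ _ p).
  - by rewrite monicE lead_coefZ lead_coef_map_eq // -/c mulVf.
  - rewrite rootE /p hornerZ (@horner_coef_wide _ (size (G j))) ?size_poly //.
    rewrite -[X in _ * X](_ :
        rho (\sum_(l < size (G j)) phi (G j)`_l * x j ^+ l) = _).
      by rewrite Gx rmorph0 mulr0.
    rewrite rmorph_sum; apply: eq_bigr => l _.
    by rewrite coef_map rmorphM rmorphXn -psiE.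
  - apply/integral_poly => i; rewrite /p coefZ coef_map /=.
    pose q := (G j)`_i * \prod_(j' | j' != j) lead_coef (G j').
    have sE : psi s = c * psi (\prod_(j' | j' != j) lead_coef (G j')).
      by rewrite -rmorphM /s (bigD1 j).
    have -> : c^-1 * psi (G j)`_i = iota (q%:P * 'X); last exact: integral_id.
    rewrite rmorphM iotaC iotaX /u rmorphM sE invfM mulrACA divff ?mulr1 1?mulrC //.
    by apply: contra_neq psis; rewrite sE => ->; rewrite mulr0.
have [q qm qb] : integralOver iota (rho b).
  have [p ->] := x_generate b; rewrite rmorph_sum.
  elim/big_ind: _ => [||e _]; [exact: integral0|exact: integral_add|].
  rewrite rmorphM; apply: integral_mul.
    by rewrite -psiE -iotaC; exact: integral_id.
  rewrite rmorph_prod; elim/big_ind: _ => [||j _].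
  - exact: integral1.
  - exact: integral_mul.
  rewrite rmorphXn; elim: (e j) => [|k IHk]; first by rewrite expr0; exact: integral1.
  by rewrite exprS; apply: integral_mul.
pose N := (\max_(l < size q) size (q`_l)%R)%N.
have qN l : (size (q`_l)%R <= N)%N.
  have [lq|ql] := ltnP l (size q); first exact: (leq_bigmax (Ordinal lq)).
  by rewrite nth_default // size_poly0.
pose h l : mpoly m R := \sum_(i < N.+1) (q`_l)`_i * s ^+ (N - i).
have hE l : psi (h l) = psi s ^+ N * iota q`_l.
  rewrite iotaE (@horner_coef_wide _ N.+1); last first.
    by apply: leq_trans (size_poly _ _) _; exact: leqW.
  rewrite rmorph_sum mulr_sumr; apply: eq_bigr => i _.
  rewrite coef_map rmorphM rmorphXn mulrCA; congr (_ * _).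
  have si0 : psi s ^+ i != 0 by rewrite expf_neq0.
  by apply: (mulIf si0); rewrite /u exprVn divfK // -exprD subnK // -ltnS.
have qS : (size q).-1.+1 = size q by rewrite prednK // size_poly_gt0 monic_neq0.
exists N, (size q).-1, h; split.
  rewrite /h (_ : q`_(size q).-1 = 1); last exact/monicP.
  rewrite big_ord_recl /= coef1 mul1r subn0 big1 ?addr0 // => i _.
  by rewrite coef1 mul0r.
apply/rho0; rewrite qS rmorph_sum.
transitivity (psi s ^+ N * (map_poly iota q).[rho b]).
  rewrite (@horner_coef_wide _ (size q)) ?size_poly // mulr_sumr.
  apply: eq_bigr => l _; by rewrite rmorphM rmorphXn coef_map mulrA -hE psiE.
by rewrite (rootP qb) mulr0.
Qed.

(** The kernels of these maps form a chain of primes of the polynomial ring; no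
    power of s belongs to them when s does not vanish at c. *)
Definition specialize (c : 'I_m -> R) i : mpoly m R -> mpoly m R :=
  mmap (@mpolyC m R) (fun j : 'I_m =>
    if (j < i)%N then mpolyC m (c j) else mpolyX R (mnm1 j)).

HB.instance Definition _ c i :=
  GRing.RMorphism.copy (specialize c i) (mmap (@mpolyC m R) (fun j : 'I_m =>
    if (j < i)%N then mpolyC m (c j) else mpolyX R (mnm1 j))).

Lemma specialize_specialize c i F :
  specialize c i.+1 (specialize c i F) = specialize c i.+1 F.
Proof.
rewrite {2 3}/specialize /mmap rmorph_sum; apply: eq_bigr => e _.
rewrite rmorphM /mmap1 rmorph_prod; congr (_ * _); first exact: mmapC.
apply: eq_bigr => j _; rewrite rmorphXn; congr (_ ^+ _).
case: (ltnP j i) => [ji|ij]; first by rewrite (ltn_trans ji) // [LHS]mmapC.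
by rewrite [LHS]mmapX mmap1U.
Qed.

Lemma meval_specialize c i F : meval c (specialize c i F) = meval c F.
Proof.
rewrite meval_mmap; apply: meval_eq => j.
by case: ltnP; rewrite ?mevalC ?mevalXU.
Qed.

(** If v in the polynomial ring were congruent to y b modulo P, with
    y = X_i - c_i, then the integral equation of b, made homogeneous, would read
    s^N v^d = 0 modulo y, so that the specialization of v would be zero.  Hence
    some prime over P contains y and contracts into the next kernel. *)
Lemma going_up (P0 P : prime_ideal A) s c (i : 'I_m) :
  (forall b, exists N d (h : nat -> mpoly m R),
    h d = s ^+ N /\ prime_carrier P0 (\sum_(l < d.+1) phi (h l) * b ^+ l)) ->
  meval c s != 0 -> P0 `<=` P ->
  (forall F, prime_carrier P (phi F) -> specialize c i F = 0) ->
  exists P' : prime_ideal A,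
    [/\ P `<=` P', prime_carrier P' (phi (mpolyX R (mnm1 i) - mpolyC m (c i)))
      & forall F, prime_carrier P' (phi F) -> specialize c i.+1 F = 0].
Proof.
move=> integral cs P0P Pi; set y := mpolyX R (mnm1 i) - mpolyC m (c i).
have y0 : specialize c i.+1 y = 0.
  by rewrite rmorphB /= /specialize mmapC mmapX mmap1U ltnSn subrr.
pose T := [set phi F | F in [set F | specialize c i.+1 F != 0]].
pose I := [set a | exists w b, prime_carrier P w /\ a = w + phi y * b].
have [|||||a [w [b [Pw aE]]] [v /= v0 va]|P' [IP' P'T]] := @prime_avoiding A I T.
- by exists 0, 0; rewrite mulr0 addr0; split=> //; exact: prime_ideal0.
- move=> _ _ [w [b [Pw ->]]] [w' [b' [Pw' ->]]]; exists (w + w'), (b + b').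
  by rewrite mulrDr addrACA; split=> //; exact: prime_idealD.
- move=> a _ [w [b [Pw ->]]]; exists (a * w), (a * b).
  by rewrite mulrDr mulrCA; split=> //; exact: prime_idealMl.
- by exists 1; rewrite /= ?rmorph1 //; exact: oner_neq0.
- move=> _ _ [F F0 <-] [G G0 <-]; exists (F * G); last by rewrite rmorphM.
  by rewrite /= rmorphM mulf_neq0.
- have [N [d [h [hd hb]]]] := integral b.
  have [K [rho rho0]] : exists (K : fieldType) (rho : {rmorphism A -> K}),
      forall a, rho a = 0 <-> prime_carrier P a.
    by exists (residue_field P), (residue_map P) => e; exact: residue_eq0.
  have vE : rho (phi v) = rho (phi y) * rho b.
    by rewrite va aE rmorphD rmorphM (rho0 w).2 // add0r.
  (* The equation of b multiplied by y^d, with y b replaced by v. *)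
  pose E := \sum_(l < d.+1) h l * y ^+ (d - l) * v ^+ l.
  have PE : prime_carrier P (phi E).
    apply/rho0; rewrite /E !rmorph_sum.
    transitivity (rho (phi y) ^+ d * rho (\sum_(l < d.+1) phi (h l) * b ^+ l)).
      rewrite rmorph_sum mulr_sumr; apply: eq_bigr => l _.
      have -> : rho (phi y) ^+ d = rho (phi y) ^+ (d - l) * rho (phi y) ^+ l.
        by rewrite -exprD subnK // -ltnS.
      rewrite !rmorphM !rmorphXn vE exprMn.
      by move: (rho (phi y) ^+ (d - l)) (rho (phi y) ^+ l) => yd yl; ring.
    by rewrite ((rho0 _).2 (P0P _ hb)) mulr0.
  have := Pi _ PE => /(congr1 (specialize c i.+1)).
  rewrite specialize_specialize rmorph0 /E big_ord_recr rmorphD rmorph_sum /=.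
  rewrite big1 ?add0r => [|l _]; last first.
    rewrite !rmorphM !rmorphXn /= y0 expr0n subn_eq0 leqNgt ltn_ord.
    by rewrite mulr0 mul0r.
  rewrite subnn expr0 mulr1 hd rmorphM !rmorphXn /= => /eqP.
  rewrite mulf_eq0 !expf_eq0 (negPf v0) andbF orbF => /andP[_ /eqP s0].
  by move: cs; rewrite -(meval_specialize c i.+1) s0 raddf0 eqxx.
exists P'; split=> [w Pw||F P'F].
- by apply: IP'; exists w, 0; rewrite mulr0 addr0.
- apply: IP'; exists 0, 1; rewrite add0r mulr1; split=> //; exact: prime_ideal0.
- by apply: contrapT => /eqP F0; apply: (P'T _ P'F); exists F.
Qed.

Lemma chain_of_independent : exists P : 'I_m.+1 -> prime_ideal A,
  forall i j : 'I_m.+1, (i < j)%N -> P i `<` P j.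
Proof.
have [P0 P0phi] := prime_above0.
have [s s0 integral] := integral_after_localization P0phi.
have [c cs] := mpoly_nonroot s0.
suff /(_ m (leqnn m))[P [PS _ _]] : forall i, (i <= m)%N ->
    exists P : nat -> prime_ideal A,
    [/\ forall j, (j < i)%N -> P j `<=` P j.+1 /\ ~ P j.+1 `<=` P j,
        P0 `<=` P i
      & forall F, prime_carrier (P i) (phi F) -> specialize c i F = 0].
  have Ple j k : (j <= k <= m)%N -> P j `<=` P k.
    elim: k => [|k IHk] /andP[]; first by rewrite leqn0 => /eqP -> _ a.
    rewrite leq_eqVlt => /orP[/eqP -> _ a //|jk] km a Pja.
    have jkm : (j <= k <= m)%N by apply/andP; split; [exact: jk|exact: ltnW].
    exact: (PS k km).1 _ (IHk jkm _ Pja).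
  exists (fun i => P i) => i j ij; split.
    by apply: Ple; apply/andP; split; [exact: ltnW|rewrite -ltnS].
  have im : (i < m)%N by rewrite (leq_trans ij) // -ltnS.
  move=> Pji; apply: (PS i im).2 => a Pa; apply: Pji.
  by apply: Ple Pa; apply/andP; split; last rewrite -ltnS.
elim=> [_|i IHi im].
  by exists (fun=> P0); split=> // F /P0phi ->; rewrite rmorph0.
have [P [PS P0P Pphi]] := IHi (ltnW im).
have [P' [PP' P'y P'phi]] :=
  @going_up P0 (P i) s c (Ordinal im) integral cs P0P Pphi.
exists (fun j => if j == i.+1 then P' else P j); split.
- move=> j; rewrite ltnS leq_eqVlt => /orP[/eqP ->|ji].
    rewrite eqxx ltn_eqF //; split=> // /(_ _ P'y)/Pphi.
    rewrite rmorphB /= /specialize mmapC mmapX mmap1U ltnn.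
    move=> /(congr1 (meval (fun=> c (Ordinal im) + 1))).
    rewrite raddf0 mevalB mevalXU mevalC addrAC subrr add0r => /eqP.
    by rewrite oner_eq0.
  by rewrite !ltn_eqF ?ltnS ?(ltnW ji) //; exact: PS.
- by rewrite eqxx => a /P0P/PP'.
- by rewrite eqxx.
Qed.

End GoingUp.

(** * Suprema of sets of natural numbers *)

Lemma infimum_min d (T : porderType d) (x0 : T) (A : set T) y :
  A y -> (forall z, A z -> (y <= z)%O) -> infimum x0 A = y.
Proof.
move=> Ay yA; have Iy : infimums A y by split => // z zA; exact: zA.
have A0 : A != set0 by apply/set0P; exists y.
rewrite /infimum (negPf A0); apply: (@is_subset1_infimums _ _ A) => //.
exact: (xgetPex x0 (ex_intro _ y Iy)).
Qed.

Lemma sup_nat_supremums P k : P k ->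
  supremums [set i%:Z%:E | i in (P : set nat)] (sup_nat P).
Proof.
move=> Pk; set A := [set i%:Z%:E | i in _].
have A0 : A != set0 by apply/set0P; exists k%:Z%:E; exists k.
suff [s As] : exists s, supremums A s.
  by rewrite /sup_nat /supremum (negPf A0); exact: (xgetPex -oo%E (ex_intro _ s As)).
have [[N PN]|Punb] := pselect (exists N, forall i, P i -> (i <= N)%N).
  have exP : exists i, `[< P i >] by exists k; apply/asboolP.
  have leP i : `[< P i >] -> (i <= N)%N by move=> /asboolP/PN.
  case: (ex_maxnP exP leP) => i /asboolP Pi iP; exists i%:Z%:E; split.
    by move=> _ [j Pj <-]; rewrite lee_fin lez_nat; apply: iP; apply/asboolP.
  by move=> y; apply; exists i.
exists +oo%E; split=> [_ [i _ <-]|y yA]; first exact: leey.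
case: y yA => [z|//|] zA; last by have := zA _ (ex_intro2 _ _ k Pk erefl).
exfalso; apply: Punb; exists `|z|%N => i Pi.
have := zA _ (ex_intro2 _ _ i Pi erefl); rewrite lee_fin => iz.
lia.
Qed.

Lemma le_sup_nat (P : nat -> Prop) k : P k -> (k%:Z%:E <= sup_nat P)%E.
Proof. by move=> Pk; have [+ _] := sup_nat_supremums Pk; apply; exists k. Qed.

Lemma sup_nat_le (P : nat -> Prop) y : (forall k, P k -> (k%:Z%:E <= y)%E) ->
  (sup_nat P <= y)%E.
Proof.
move=> Py; have [[k Pk]|P0] := pselect (exists k, P k).
  by have [_] := sup_nat_supremums Pk; apply => _ [i Pi <-]; exact: Py.
rewrite /sup_nat (_ : [set i%:Z%:E | i in (P : set nat)] = set0).
  by rewrite supremum0 leNye.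
by apply/seteqP; split=> // x [i Pi _]; apply: P0; exists i.
Qed.

(** * Dimension and independent coordinates *)

Section Coordinates.
Variables (R : rcfType) (n : nat) (Z : set 'rV[R]_n).

Definition coordinates_dependent k (g : 'I_k -> 'I_n) : Prop :=
  exists2 F : mpoly k R, F != 0 & forall z : Z, meval (val z 0 \o g) F = 0.

Definition independent_coordinates k : Prop :=
  exists2 g : 'I_k -> 'I_n, injective g & ~ coordinates_dependent g.

Lemma independent_coordinates_le k : independent_coordinates k -> (k <= n)%N.
Proof. by move=> [g /leq_card]; rewrite !card_ord. Qed.

Lemma mpoly_of_coordinates_subproof k (g : 'I_k -> 'I_n) (F : mpoly k R) :
  (fun z : Z => meval (val z 0 \o g) F) \in @poly_pred R n Z.
Proof. by apply/asboolP; exists (mrename g F) => z; rewrite meval_mrename. Qed.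

Definition mpoly_of_coordinates k (g : 'I_k -> 'I_n) F : poly_fun Z :=
  PolyFun (mpoly_of_coordinates_subproof g F).

Lemma mpoly_of_coordinates_zmod k g : zmod_morphism (@mpoly_of_coordinates k g).
Proof.
by move=> F G; apply: val_inj; apply: funext => z; exact: mevalB.
Qed.
Lemma mpoly_of_coordinates_monoid k g : monoid_morphism (@mpoly_of_coordinates k g).
Proof.
split; first by apply: val_inj; apply: funext => z; exact: meval1.
by move=> F G; apply: val_inj; apply: funext => z; exact: mevalM.
Qed.
HB.instance Definition _ k g := GRing.isZmodMorphism.Build _ _
  (@mpoly_of_coordinates k g) (mpoly_of_coordinates_zmod g).
HB.instance Definition _ k g := GRing.isMonoidMorphism.Build _ _
  (@mpoly_of_coordinates k g) (mpoly_of_coordinates_monoid g).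

Definition poly_fun_eval (z : Z) (f : poly_fun Z) : R := f z.
Lemma poly_fun_eval_zmod z : zmod_morphism (poly_fun_eval z). Proof. by []. Qed.
Lemma poly_fun_eval_monoid z : monoid_morphism (poly_fun_eval z). Proof. by []. Qed.
HB.instance Definition _ z := GRing.isZmodMorphism.Build _ _
  (poly_fun_eval z) (poly_fun_eval_zmod z).
HB.instance Definition _ z := GRing.isMonoidMorphism.Build _ _
  (poly_fun_eval z) (poly_fun_eval_monoid z).

Lemma poly_fun_eqP (f g : poly_fun Z) :
  (forall z, poly_fun_eval z f = poly_fun_eval z g) -> f = g.
Proof. by move=> fg; apply: val_inj; apply: funext. Qed.

Lemma poly_fun_eval_mpoly k (g : 'I_k -> 'I_n) F z :
  poly_fun_eval z (mpoly_of_coordinates g F) = meval (val z 0 \o g) F.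
Proof. by []. Qed.

(** Independent coordinates in the largest possible number m make every other
    coordinate algebraic over them, since adding it gives a relation. *)
Lemma independent_coordinates_dim k : independent_coordinates k ->
  (k%:Z%:E <= semialg_dim Z)%E.
Proof.
move=> indk; have ex_ind : exists m, `[< independent_coordinates m >].
  by exists k; apply/asboolP.
have ind_le m : `[< independent_coordinates m >] -> (m <= n)%N.
  by move=> /asboolP/independent_coordinates_le.
case: (ex_maxnP ex_ind ind_le) => m /asboolP[g g_inj g_ind] m_max.
have /m_max km : `[< independent_coordinates k >] by apply/asboolP.
apply: (@le_trans _ _ m%:Z%:E); first by rewrite lee_fin lez_nat.
apply: le_sup_nat.
pose X (j : 'I_n) : poly_fun Z :=
  mpoly_of_coordinates (@id 'I_n) (mpolyX R (mnm1 j)).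
have XE j z : poly_fun_eval z (X j) = val z 0 j.
  by rewrite poly_fun_eval_mpoly mevalXU.
apply: (@chain_of_independent R m n _ (mpoly_of_coordinates g) X).
- move=> F F0; apply: contrapT => /eqP Fn0; apply: g_ind; exists F => // z.
  by rewrite -poly_fun_eval_mpoly F0 rmorph0.
- move=> j; pose g' (i : 'I_m.+1) := if unlift ord_max i is Some i' then g i' else j.
  have g'max : g' ord_max = j by rewrite /g' unlift_none.
  have g'lift i : g' (lift ord_max i) = g i by rewrite /g' liftK.
  have [F F0 FZ] : coordinates_dependent g'.
    (* A coordinate that already occurs in g satisfies X_max - X_i. *)
    have [[i gi]|gj] := pselect (exists i, g i = j).
      exists (mpolyX R (mnm1 ord_max) - mpolyX R (mnm1 (lift ord_max i))).
        apply/eqP => /(congr1 (meval (fun i => (i == ord_max)%:R))) /eqP.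
        rewrite mevalB !mevalXU raddf0 eqxx [lift _ _ == _]eq_sym.
        by rewrite (negPf (neq_lift _ _)) subr0 oner_eq0.
      by move=> z; rewrite mevalB !mevalXU /= g'max g'lift gi subrr.
    apply: contrapT => g'_ind.
    have /m_max : `[< independent_coordinates m.+1 >]; last by rewrite ltnn.
    apply/asboolP; exists g' => // i i'.
    case: (unliftP ord_max i) => [l|] ->; case: (unliftP ord_max i') => [l'|] -> //.
    + by rewrite !g'lift => /g_inj ->.
    + by rewrite g'lift g'max => gl; case: gj; exists l.
    + by rewrite g'lift g'max => gl; case: gj; exists l'.
  exists (univariate (unlift ord_max) F).
    apply: (@univariate_neq0 _ _ _ _ (oapp (lift ord_max) ord_max)) => // i.
    by case: unliftP.
  apply: poly_fun_eqP => z; rewrite rmorph_sum rmorph0.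
  pose v := val z 0 \o g.
  transitivity ((map_poly (meval v) (univariate (unlift ord_max) F)).[val z 0 j]).
    rewrite (@horner_coef_wide _ (size (univariate (unlift ord_max) F)));
      last exact: size_poly.
    apply: eq_bigr => l _; rewrite rmorphM rmorphXn coef_map.
    by congr (_ * _ ^+ _); exact: XE.
  rewrite horner_univariate -[RHS](FZ z); apply: meval_eq => i /=.
  by rewrite /g'; case: unlift.
- move=> b; have /asboolP[p pE] := poly_funP b; exists p.
  apply: poly_fun_eqP => z; rewrite rmorph_sum [LHS]pE mevalE.
  apply: eq_bigr => e _; rewrite rmorphM; congr (_ * _).
    by symmetry; exact: mevalC.
  rewrite rmorph_prod; apply: eq_bigr => j _; rewrite rmorphXn; congr (_ ^+ _).
  by rewrite -XE.
Qed.

(** A chain of primes gives k algebraically independent polynomial functions,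
    and polynomial functions are the simplest piecewise algebraic ones. *)
Lemma chain_independent_coordinates k :
  (exists P : 'I_k.+1 -> prime_ideal (poly_fun Z),
    forall i j : 'I_k.+1, (i < j)%N -> P i `<` P j) ->
  independent_coordinates k.
Proof.
move=> [P /(@chain_independent _ _
  (mpoly_of_coordinates (@id 'I_n) \o @mpolyC n R))[a aP]].
apply: contrapT => nind.
have [||Q Q0 Qa] := @piecewise_dependent R n Z (fun z => val z 0) k
    (fun z i => a i z).
- move=> j; have /asboolP[p pE] := poly_funP (a j).
  exists [:: 'X - p%:P] => z; exists ('X - p%:P); first exact: mem_head.
  rewrite map_polyXsubC polyXsubC_eq0; split=> //.
  by rewrite root_XsubC pE.
- move=> g g_inj; apply: contrapT => g_ind; apply: nind; exists g => //.
- apply: (negP Q0); apply/eqP/aP.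
  apply: poly_fun_eqP => z; rewrite rmorph_sum rmorph0 -[RHS](Qa z) mevalE.
  apply: eq_bigr => e _; rewrite rmorphM; congr (_ * _).
    exact: mevalC.
  by rewrite rmorph_prod; apply: eq_bigr => j _; rewrite rmorphXn.
Qed.

End Coordinates.

(** * Transcendence degree of residue fields *)

Local Open Scope quotient_scope.

Lemma fraction_numden (D : idomainType) (y : {fraction D}) :
  exists a b : D, b != 0 /\ y = tofrac a / tofrac b.
Proof.
elim/quotW: y => f; exists (frac f).1, (frac f).2; split; first exact: denom_ratioP.
have d0 : tofrac (frac f).2 != 0 by rewrite tofrac_eq0 denom_ratioP.
apply: (mulIf d0); rewrite divfK //; unlock tofrac; rewrite -[LHS]FracField.pi_mul.
apply/eqmodP; rewrite /= FracField.equivfE /FracField.mulf.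
rewrite !numden_Ratio ?oner_eq0 ?mulf_neq0 ?oner_neq0 ?denom_ratioP // !mulr1.
by rewrite mulrC.
Qed.

Lemma residue_fraction (A : comPzRingType) (P : prime_ideal A)
    (y : residue_field P) :
  exists a b, residue_map P b != 0 /\ y = residue_map P a / residue_map P b.
Proof.
have proj_surj (q : prime_quot P) : exists a, prime_proj P a = q.
  by elim/quotW: q => a; exists a.
have [q [d [d0 ->]]] := fraction_numden y.
have [a aq] := proj_surj q; have [b bd] := proj_surj d.
exists a, b; rewrite -aq -bd in d0 *; split=> //.
by rewrite -[residue_map P b]/(tofrac (prime_proj P b)) tofrac_eq0.
Qed.

(** At b = 0 both sides vanish, by the convention that division by 0 gives 0. *)
Lemma mulX_divX (K : fieldType) (a b : K) m N : (m < N)%N ->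
  b ^+ N * (a / b) ^+ m = a ^+ m * b ^+ (N - m).
Proof.
move=> mN; rewrite exprMn exprVn; have [->|b0] := eqVneq b 0.
  have Nm : (N - m == 0)%N = false by rewrite subn_eq0 leqNgt mN.
  have N0 : (N == 0)%N = false by rewrite gtn_eqF // (leq_ltn_trans _ mN).
  by rewrite !expr0n Nm N0 mulr0 mul0r.
rewrite mulrCA; congr (_ * _); rewrite -{1}(subnK (ltnW mN)) exprD mulfK //.
exact: expf_neq0.
Qed.

(** [ev] evaluates the elements of A at the points of Z, where Z is M itself, or
    Z(f) for f in a prime z-ideal. *)
Section ResidueBound.
Variables (R : rcfType) (n : nat) (Z : set 'rV[R]_n) (A : comPzRingType).
Variables (P : prime_ideal A) (cst : {rmorphism R -> A}).
Variable ev : Z -> {rmorphism A -> R}.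
Hypothesis ev_cst : forall z c, ev z (cst c) = c.
Hypothesis ev_eq0 : forall a, (forall z, ev z a = 0) -> prime_carrier P a.
Hypothesis ev_algebraic : forall a b,
  piecewise_algebraic (fun z : Z => val z 0) (fun z => ev z a / ev z b).

(** A relation between the pointwise quotients of the representatives holds in
    the residue field, because P contains what vanishes on Z. *)
Lemma residue_independent_coordinates k (y : 'I_k -> residue_field P) :
  alg_indep (residue_map P \o cst) y -> independent_coordinates Z k.
Proof.
move=> y_indep; apply: contrapT => nind.
have /choice[a /choice[b abE]] i := residue_fraction (y i).
have [||Q /eqP Q0 Qab] := @piecewise_dependent R n Z (fun z => val z 0) k
    (fun z i => ev z (a i) / ev z (b i)).
- by move=> j; exact: ev_algebraic.
- by move=> g g_inj; apply: contrapT => g_ind; apply: nind; exists g.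
apply: Q0; apply: y_indep.
pose N := msize Q.
have eN m : m \in msupp Q -> forall i, (m i < N)%N.
  move=> mQ i; apply: leq_ltn_trans (msize_mdeg_lt mQ).
  by rewrite mdegE (bigD1 i) //= leq_addr.
(* The relation multiplied by the N-th powers of the denominators; it holds at
   the zeros of the denominators too, because N exceeds the degree of Q. *)
pose H := \sum_(m <- msupp Q)
  cst (mcoeff m Q) * \prod_i (a i ^+ m i * b i ^+ (N - m i)).
have PH : prime_carrier P H.
  apply: ev_eq0 => z.
  transitivity ((\prod_i ev z (b i) ^+ N) *
    meval (fun i => ev z (a i) / ev z (b i)) Q); last by rewrite Qab mulr0.
  rewrite mevalE mulr_sumr rmorph_sum big_seq [RHS]big_seq.
  apply: eq_bigr => m mQ; rewrite rmorphM ev_cst mulrCA; congr (_ * _).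
  rewrite rmorph_prod -big_split; apply: eq_bigr => i _.
  by rewrite rmorphM !rmorphXn /= mulX_divX // eN.
have b0 : \prod_i residue_map P (b i) ^+ N != 0.
  by apply/prodf_neq0 => i _; rewrite expf_neq0 //; have [] := abE i.
apply: (mulfI b0); rewrite mulr0.
have /residue_eq0 <- := PH.
rewrite /H rmorph_sum /mmap mulr_sumr big_seq [RHS]big_seq.
apply: eq_bigr => m mQ; rewrite rmorphM mulrCA; congr (_ * _).
rewrite rmorph_prod /mmap1 -big_split; apply: eq_bigr => i _.
have [_ ->] := abE i.
by rewrite rmorphM !rmorphXn /= mulX_divX // eN.
Qed.

Lemma residue_trdeg_le : (trdeg (residue_map P \o cst) <= semialg_dim Z)%E.
Proof.
apply: sup_nat_le => k [y /residue_independent_coordinates].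
exact: independent_coordinates_dim.
Qed.

Lemma residue_trdeg_fin : trdeg (residue_map P \o cst) \is a fin_num.
Proof.
apply/fin_numPlt/andP; split.
  apply: lt_le_trans (@le_sup_nat _ 0 _); first exact: ltNyr.
  exists (fun=> 0) => Q.
  rewrite [Q]nvar0_mpolyC mmapC => /eqP; rewrite fmorph_eq0 => /eqP ->.
  by rewrite mpolyC0.
apply: le_lt_trans (_ : n%:Z%:E < +oo)%E; last exact: ltry.
apply: sup_nat_le => k [y /residue_independent_coordinates].
by move=> /independent_coordinates_le kn; rewrite lee_fin lez_nat.
Qed.

End ResidueBound.

(** * Semialgebraic function rings *)

Section SemialgebraicRing.
Variables (R : rcfType) (n : nat) (M : semialg_set R n).

Definition semialg_eval (x : M) (f : semialg_fun M) : R := f x.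
Lemma semialg_eval_zmod x : zmod_morphism (semialg_eval x). Proof. by []. Qed.
Lemma semialg_eval_monoid x : monoid_morphism (semialg_eval x). Proof. by []. Qed.
HB.instance Definition _ x := GRing.isZmodMorphism.Build _ _
  (semialg_eval x) (semialg_eval_zmod x).
HB.instance Definition _ x := GRing.isMonoidMorphism.Build _ _
  (semialg_eval x) (semialg_eval_monoid x).

(** The quotient need not be continuous, nor defined where g vanishes; with the
    value 0 there its graph is semialgebraic. *)
Lemma semialg_div_algebraic (f g : semialg_fun M) :
  piecewise_algebraic (fun x : M => val x 0) (fun x => f x / g x).
Proof.
apply: semialg_piecewise_algebraic.
have /asboolP[sf _] := semialg_funP f; have /asboolP[sg _] := semialg_funP g.
exact: (@semialg_graph_op _ _ _ (fun a b => a / b)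
  (fun t u => GRing.Mul t (GRing.Inv u))).
Qed.

Lemma coordinate_subproof (j : 'I_n) :
  (fun x : M => val x 0 j) \in @semialg_pred R n M.
Proof.
apply/asboolP; split; last by move=> x e e0; exists e => // y /(_ j).
have /semialgebraic_definable[F FP] := semialg_setP M.
apply: definable_semialgebraic.
exists (ordered_qelim.ord.And F
  (ordered_qelim.ord.Equal (GRing.Var R n) (GRing.Var R j))) => e /=.
rewrite FP; split=> [[Me en]|[x _ xe]].
  exists (exist _ (env_row n e) (mem_set Me)) => //=.
  apply/rowP => i; rewrite !mxE; case: (split_ordP i) => l ->.
    by rewrite mxE.
  by rewrite !ord1 mxE eqxx mulr1n /= addn0 en.
have xn : val x = env_row n e.
  apply/rowP => i; have /rowP/(_ (lshift 1 i)) := xe.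
  by rewrite row_mxEl !mxE.
split; first by rewrite -xn; apply: set_mem (valP x).
have /rowP/(_ (rshift n 0)) := xe.
by rewrite row_mxEr !mxE /= addn0 => <-; rewrite xn mxE.
Qed.

Definition coordinate (j : 'I_n) : semialg_fun M :=
  SemialgFun (coordinate_subproof j).

Definition semialg_of_mpoly k (g : 'I_k -> 'I_n) (F : mpoly k R) : semialg_fun M :=
  \sum_(m <- msupp F) semialg_cst M (mcoeff m F) * \prod_i coordinate (g i) ^+ m i.

Lemma semialg_eval_mpoly k (g : 'I_k -> 'I_n) F x :
  semialg_eval x (semialg_of_mpoly g F) = meval (val x 0 \o g) F.
Proof.
rewrite rmorph_sum mevalE; apply: eq_bigr => m _; rewrite rmorphM; congr (_ * _).
by rewrite rmorph_prod; apply: eq_bigr => i _; rewrite rmorphXn.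
Qed.

Lemma semialg_trdeg (p : prime_ideal (semialg_fun M)) :
  trdeg (semialg_residue_cst p) \is a fin_num /\
  (trdeg (semialg_residue_cst p) <= semialg_dim M)%E.
Proof.
have ev0 a : (forall x, semialg_eval x a = 0) -> prime_carrier p a.
  move=> a0; suff -> : a = 0 by exact: prime_ideal0.
  by apply: val_inj; apply: funext.
have alg a b : piecewise_algebraic (fun x : M => val x 0)
    (fun x => semialg_eval x a / semialg_eval x b) by exact: semialg_div_algebraic.
split; first exact: (@residue_trdeg_fin R n M _ p _ semialg_eval).
exact: (@residue_trdeg_le R n M _ p _ semialg_eval).
Qed.

Definition bsemialg_eval (x : M) (f : bsemialg_fun M) : R := f x.
Lemma bsemialg_eval_zmod x : zmod_morphism (bsemialg_eval x). Proof. by []. Qed.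
Lemma bsemialg_eval_monoid x : monoid_morphism (bsemialg_eval x). Proof. by []. Qed.
HB.instance Definition _ x := GRing.isZmodMorphism.Build _ _
  (bsemialg_eval x) (bsemialg_eval_zmod x).
HB.instance Definition _ x := GRing.isMonoidMorphism.Build _ _
  (bsemialg_eval x) (bsemialg_eval_monoid x).

Lemma bsemialg_trdeg (p : prime_ideal (bsemialg_fun M)) :
  trdeg (bsemialg_residue_cst p) \is a fin_num /\
  (trdeg (bsemialg_residue_cst p) <= semialg_dim M)%E.
Proof.
have ev0 a : (forall x, bsemialg_eval x a = 0) -> prime_carrier p a.
  move=> a0; suff -> : a = 0 by exact: prime_ideal0.
  by do 2 apply: val_inj; apply: funext.
have alg a b : piecewise_algebraic (fun x : M => val x 0)
    (fun x => bsemialg_eval x a / bsemialg_eval x b) by exact: semialg_div_algebraic.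
split; first exact: (@residue_trdeg_fin R n M _ p _ bsemialg_eval).
exact: (@residue_trdeg_le R n M _ p _ bsemialg_eval).
Qed.

Section Zideal.
Variable p : prime_ideal (semialg_fun M).

Lemma trdeg_le_zeros (f : semialg_fun M) : z_ideal p -> prime_carrier p f ->
  (trdeg (semialg_residue_cst p) <= semialg_dim (zeros f))%E.
Proof.
move=> zp pf.
have /choice[inc incP] (z : zeros f) : exists x : M, val x = val z /\ f x = 0.
  by have [x fx xz] := set_mem (valP z); exists x.
apply: (@residue_trdeg_le R n (zeros f) _ p _ (fun z => semialg_eval (inc z))) => //.
- move=> a a0; apply: (zp f a) => // _ [x fx <-].
  have zx : zeros f (val x) by exists x.
  exists x => //=; have := a0 (exist _ (val x) (mem_set zx)).
  have [+ _] := incP (exist _ (val x) (mem_set zx)).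
  by move=> /val_inj -> .
- move=> a b; have [L LP] := semialg_div_algebraic a b; exists L => z.
  by rewrite -(incP z).1; exact: LP.
Qed.

(** f is the sum of the squares of one relation in p for every family of
    coordinates that has one.  Each of these relations vanishes on Z(f), so a
    family independent on Z(f) is independent modulo p. *)
Lemma zeros_le_trdeg : exists2 f, prime_carrier p f &
  (semialg_dim (zeros f) <= trdeg (semialg_residue_cst p))%E.
Proof.
pose vanishing k (g : 'I_k -> 'I_n) (G : mpoly k R) :=
  prime_carrier p (semialg_of_mpoly g G).
have exF k (g : 'I_k -> 'I_n) : exists F : mpoly k R, vanishing k g F /\
    ((exists2 G, G != 0 & vanishing k g G) -> F != 0).
  have [[G G0 pG]|nG] := pselect (exists2 G, G != 0 & vanishing k g G).
    by exists G.
  exists 0; split=> //; rewrite /vanishing /semialg_of_mpoly msupp0 big_nil.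
  exact: prime_ideal0.
pose F k g := projT1 (cid (exF k g)).
have FP k g : vanishing k g (F k g) /\
    ((exists2 G, G != 0 & vanishing k g G) -> F k g != 0).
  exact: projT2 (cid (exF k g)).
pose f := \sum_(k < n.+1) \sum_(g : {ffun 'I_k -> 'I_n})
  semialg_of_mpoly g (F k g) ^+ 2.
exists f.
  apply: prime_ideal_sum => k _; apply: prime_ideal_sum => g _.
  by rewrite expr2; apply: prime_idealMl; have [] := FP k g.
apply: sup_nat_le => k /chain_independent_coordinates indk.
have kn : (k < n.+1)%N := independent_coordinates_le indk.
have [h h_inj h_ind] := indk.
apply: le_sup_nat; exists (fun i => residue_map p (coordinate (h i))) => Q Q0.
apply: contrapT => /eqP Qn0; apply: h_ind.
pose g : {ffun 'I_k -> 'I_n} := finfun h.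
have gE i : g i = h i by rewrite ffunE.
exists (F k g).
  apply: (FP k g).2; exists Q => //; apply/residue_eq0; rewrite -[RHS]Q0.
  rewrite rmorph_sum; apply: eq_bigr => m _; rewrite rmorphM; congr (_ * _).
  by rewrite rmorph_prod; apply: eq_bigr => i _; rewrite rmorphXn gE.
move=> z; have [x fx xz] := set_mem (valP z).
have f0 : \sum_(k < n.+1) \sum_(g : {ffun 'I_k -> 'I_n})
    semialg_eval x (semialg_of_mpoly g (F k g)) ^+ 2 = 0.
  rewrite -[RHS]fx -[f x]/(semialg_eval x f) rmorph_sum; apply: eq_bigr => k' _.
  by rewrite rmorph_sum; apply: eq_bigr => g' _; rewrite rmorphXn.
have sq_ge0 k' : 0 <= \sum_(g' : {ffun 'I_k' -> 'I_n})
    semialg_eval x (semialg_of_mpoly g' (F k' g')) ^+ 2.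
  by apply: sumr_ge0 => g' _; exact: sqr_ge0.
have fk0 : \sum_(g' : {ffun 'I_k -> 'I_n})
    semialg_eval x (semialg_of_mpoly g' (F k g')) ^+ 2 = 0.
  have := psumr_eq0P (fun k' _ => sq_ge0 (nat_of_ord k')) f0.
  by move=> /(_ (Ordinal kn) isT).
have /(_ g isT)/eqP := psumr_eq0P (fun g' _ => sqr_ge0 _) fk0.
rewrite sqrf_eq0 semialg_eval_mpoly => /eqP Fx.
by rewrite -[RHS]Fx -xz; apply: meval_eq => i /=; rewrite -gE.
Qed.

Lemma z_ideal_depth : z_ideal p ->
  semialg_depth p = trdeg (semialg_residue_cst p).
Proof.
move=> zp; have [f pf fle] := zeros_le_trdeg.
have fE : semialg_dim (zeros f) = trdeg (semialg_residue_cst p).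
  by apply/eqP; rewrite eq_le fle trdeg_le_zeros.
apply: infimum_min; first by exists f.
by move=> _ [h ph <-]; exact: trdeg_le_zeros.
Qed.

End Zideal.
End SemialgebraicRing.

Local Open Scope ereal_scope.

Theorem theorem3 (R : rcfType) (n : nat) (M : semialg_set R n) :
  ((forall p : prime_ideal (semialg_fun M),
      trdeg (semialg_residue_cst p) \is a fin_num /\
      trdeg (semialg_residue_cst p) <= semialg_dim M) /\
   (forall p : prime_ideal (bsemialg_fun M),
      trdeg (bsemialg_residue_cst p) \is a fin_num /\
      trdeg (bsemialg_residue_cst p) <= semialg_dim M)) /\
  (forall p : prime_ideal (semialg_fun M),
      z_ideal p -> semialg_depth p = trdeg (semialg_residue_cst p)).
Proof.
split; last exact: z_ideal_depth.
by split; [exact: semialg_trdeg|exact: bsemialg_trdeg].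
Qed.
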